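(* Let $\mu>0$, $2<p<6$ and $\ell>0$, and let $\mathcal G$ be the metric graph consisting of two half-lines and one bounded edge (the pendant) of length $\ell$, joined at their initial point. Identify each $u\in H^1(\mathcal G)$ with a pair $(\phi,\psi)$, where $\phi\in H^1(\mathbb R)$, $\psi\in H^1(I)$, $I=[0,\ell]$ and $\phi(0)=\psi(0)$. Assume that $u=(\phi,\psi)\in H^1_\mu(\mathcal G)$, with $u>0$ and $\mathrm{meas}(\{u=t\})=0$ for every $t>0$. Then there exists $\widetilde u\in H^1_\mu(\mathcal G)$, $\widetilde u=(\widetilde\phi,\widetilde\psi)$, with the following properties: (i) $\widetilde\phi:\mathbb R\to\mathbb R$ is even and radially decreasing; (ii) $\widetilde\psi:I\to\mathbb R$ is increasing, so that $\min\widetilde\psi=\widetilde\psi(0)=\widetilde\phi(0)=\max\widetilde\phi$; (iii) $E(\widetilde u,\mathcal G)\le E(u,\mathcal G)$ and, if equality occurs, then necessarily $\psi$ is increasing on $[0,\ell]$ and $\min\psi=\max\phi$.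
   Context: The graph $\mathcal G$ has three edges: two half-lines $[0,+\infty)$ and one bounded interval $[0,\ell]$ (the pendant), whose points with coordinate $0$ are glued into a single point (the triple junction). $H^1(\mathcal G)$ is the set of real functions continuous on $\mathcal G$ whose restriction to each edge is in $H^1$ of that edge; in the identification $u=(\phi,\psi)$, $\mathbb R$ represents the union of the two half-lines (with $0$ the triple junction) and $I=[0,\ell]$ represents the pendant (with $0$ the triple junction and $\ell$ the tip). $H^1_\mu(\mathcal G)$ is the set of $u=(\phi,\psi)\in H^1(\mathcal G)$ with $\int_{-\infty}^{\infty}|\phi|^2\,dx+\int_0^\ell|\psi|^2\,dx=\mu$. The measure $\mathrm{meas}$ on $\mathcal G$ is the sum of the Lebesgue measures on the edges. The energy is $$E(u,\mathcal G)=\tfrac12\int_{\mathbb R}|\phi'|^2\,dx-\tfrac1p\int_{\mathbb R}|\phi|^p\,dx+\tfrac12\int_0^\ell|\psi'|^2\,dx-\tfrac1p\int_0^\ell|\psi|^p\,dx .$$ *)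

(* Defs.v *)
From HB Require Import structures.
From mathcomp Require Import all_boot all_order all_algebra.
From mathcomp Require Import all_classical all_reals all_analysis.
Set Implicit Arguments.
Unset Strict Implicit.
Unset Printing Implicit Defensive.
Import Order.TTheory GRing.Theory Num.Theory.
Import numFieldNormedType.Exports.
Local Open Scope classical_set_scope.
Local Open Scope ring_scope.

Section Sobolev.
Context {R : realType}.
Notation mu := (@lebesgue_measure R).
Implicit Types (D : set R) (u g eta : R -> R).

Definition square_integrable D u : Prop :=
  measurable_fun D u /\ mu.-integrable D (fun x => (`|u x| ^+ 2)%:E).

(* C^1 functions with compact support in the interior of D, extended by 0. *)
Definition test_function D eta : Prop :=
  [/\ forall x, derivable eta x 1,
      continuous (derive1 eta)
    & exists K : set R,
        [/\ compact K, K `<=` interior D & forall x, ~ K x -> eta x = 0]].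

Definition is_weak_derivative D u g : Prop :=
  forall eta, test_function D eta ->
    \int[mu]_(x in D) (u x * derive1 eta x) = - \int[mu]_(x in D) (g x * eta x).

(* H^1(D) for an interval D. Its elements are taken to be the continuous
   representatives; values outside D are irrelevant. *)
Definition H1 D u : Prop :=
  [/\ {within D, continuous u}, square_integrable D u
    & exists g, square_integrable D g /\ is_weak_derivative D u g].

(* The weak derivative is unique only up to null sets: some version of it is
   selected, and it is only ever used under an integral. *)
Definition weak_derivative D u : R -> R :=
  xget (fun _ => 0)
       [set g | square_integrable D g /\ is_weak_derivative D u g].

End Sobolev.

(* A function on the graph is a pair (phi, psi): phi on the whole line (the two
   half-lines, with the triple junction at 0) and psi on [0, l] (the pendant,
   with its tip at l); psi is never evaluated outside [0, l]. *)
Section Graph.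
Context {R : realType}.
Notation mu := (@lebesgue_measure R).
Implicit Types (l mass p t m : R) (phi psi : R -> R) (A : set R).

Definition pendant l : set R := `[0, l]%classic.

Definition H1_graph l phi psi : Prop :=
  [/\ H1 setT phi, H1 (pendant l) psi & phi 0 = psi 0].

Definition H1_graph_mass l mass phi psi : Prop :=
  H1_graph l phi psi /\
  \int[mu]_x (`|phi x| ^+ 2) + \int[mu]_(x in pendant l) (`|psi x| ^+ 2) = mass.

(* The integrals are real-valued; all of them are finite on H1_graph. *)
Definition energy l p phi psi : R :=
    2^-1 * \int[mu]_x (`|weak_derivative setT phi x| ^+ 2)
  - p^-1 * \int[mu]_x (`|phi x| `^ p)
  + 2^-1 * \int[mu]_(x in pendant l) (`|weak_derivative (pendant l) psi x| ^+ 2)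
  - p^-1 * \int[mu]_(x in pendant l) (`|psi x| `^ p).

Definition positive_graph l phi psi : Prop :=
  (forall x, 0 < phi x) /\ (forall x, pendant l x -> 0 < psi x).

(* meas({u = t}) *)
Definition level_measure l phi psi t : \bar R :=
  (mu [set x | phi x = t] + mu (pendant l `&` [set x | psi x = t]))%E.

Definition even_function phi : Prop := forall x, phi (- x) = phi x.

Definition radially_decreasing phi : Prop :=
  forall x y, `|x| < `|y| -> phi y < phi x.

Definition increasing_on A psi : Prop :=
  forall x y, A x -> A y -> x < y -> psi x < psi y.

Definition is_minimum A m : Prop := A m /\ lbound A m.
Definition is_maximum A m : Prop := A m /\ ubound A m.

End Graph.

(* Main.v *)
(* Let m(t) be the total length of the superlevel set {u > t} and e(t) the
   Dirichlet energy of u on {u < t}. If an edge crosses the levels between s and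
   t, Cauchy-Schwarz on the part of the edge where s < u < t gives
   (t - s)^2 <= (m(s) - m(t)) (e(t) - e(s)), with an additional factor 4 on the
   left if there are two disjoint crossings. Since phi vanishes at both ends of the
   line, every level below max phi is crossed twice, and for the remaining levels
   psi is crossed at least once.
     As no level is charged, m is continuous; with v its generalized inverse put
   psit(x) = v(l - x) and phit(x) = v(l + 2|x|). Both are equimeasurable with u, so
   all L^q norms agree by the layer cake formula. The increment bounds replace the
   coarea formula: through Lebesgue-Stieltjes measures and Radon-Nikodym they make
   v locally absolutely continuous, and through difference quotients and Fatou they
   bound the energy of v by that of u. If max phi > v(l), or if phi <= v(l) but psi
   is not increasing, some window of levels above v(l) enjoys the factor 4, which
   makes the energy inequality strict. *)
Require Import Defs.
From HB Require Import structures.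
From mathcomp Require Import all_boot all_order all_algebra.
From mathcomp Require Import all_classical all_reals all_analysis.
From mathcomp Require Import measurable_realfun.
From mathcomp Require Import ring lra.
Set Implicit Arguments.
Unset Strict Implicit.
Unset Printing Implicit Defensive.
Import Order.TTheory GRing.Theory Num.Theory.
Import numFieldNormedType.Exports.
Local Open Scope classical_set_scope.
Local Open Scope ring_scope.

(** * Squared densities from increment bounds *)

(** The factors 2 and 4 balance. On each half-line [phit] runs through v at double speed, so both
    halves together cost 4 times the integral of v'^2 beyond l, which is what the factor 4 in the
    increment bound pays for. That bound is needed at every level below v(l), so phi must reach
    v(l). It does: otherwise the superlevel set of v(l), of length l, would fill the pendant and
    force psi(0) >= v(l) > phi(0). The obstacle is regularity: v is known only through its
    increments and e is used only as a monotone function. Every estimate is therefore put in the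
    form (u(y) - u(x))^2 <= (y - x) (K(y) - K(x)) with K nondecreasing. This single form yields a
    density g of u (the product is linearized by AM-GM) and then bounds the integral of g^2 by the
    increment of K. The hypothesis on levels enters through the identity m(v(s)) = s, which turns
    bounds indexed by levels into bounds indexed by positions. *)

Section Translation.
Context {R : realType}.
Notation mu := (@lebesgue_measure R).

Lemma pushforward_shift_lebesgue_measure (h : R) (A : set R) : measurable A ->
  pushforward mu (+%R h : _ -> measurableTypeR R) A = mu A.
Proof.
move=> mA; apply/esym/lebesgue_measure_unique => //=.
  exact: measurable_funD.
move=> mh X [[a b] _ <-]; rewrite /pushforward.
rewrite (_ : _ @^-1` _ = `](a - h), (b - h)]%classic); last first.
  by apply/seteqP; split => x /=; rewrite !in_itv/= ltrBlDl lerBrDl.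
rewrite !lebesgue_measure_itv/= !lte_fin ltrD2r.
by congr (if _ then _ else _); rewrite -!EFinD; congr (_%:E); ring.
Qed.

Lemma ge0_integral_shift (h : R) (D : set R) (f : R -> \bar R) : measurable D ->
  measurable_fun D f -> (forall x, D x -> 0 <= f x)%E ->
  (\int[mu]_(x in +%R h @^-1` D) f (h + x)%R = \int[mu]_(x in D) f x)%E.
Proof.
move=> mD mf f0.
transitivity (\int[pushforward mu (+%R h : _ -> measurableTypeR R)]_(x in D) f x)%E.
  rewrite [RHS]ge0_integral_pushforward//=.
    by apply: measurable_funD => //.
  by move=> x /set_mem /f0.
apply: eq_measure_integral => //=; first exact: measurable_funD.
by move=> mh A mA AS; rewrite -(pushforward_shift_lebesgue_measure h mA).
Qed.

End Translation.

Section DifferenceQuotient.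
Context {R : realType}.
Notation mu := (@lebesgue_measure R).

Lemma cvg_difference_quotient (f : R -> R) (x : R) : derivable f x 1 ->
  n.+1%:R * (f (n.+1%:R^-1 + x) - f x) @[n --> \oo] --> derive1 f x.
Proof.
move=> df; rewrite derive1E.
have /cvgr_dnbhsP := df; move=> /(_ (@harmonic R)).
move=> H; rewrite (_ : (fun n => _) =
  (fun n => (harmonic n)^-1 *: ((f \o shift x) (harmonic n *: 1) - f x))).
  by apply: H; split; [move=> n; rewrite gt_eqF// harmonic_gt0|exact: cvg_harmonic].
by apply/funext => n /=; rewrite /harmonic/= invrK [_ *: 1]mulr1.
Qed.

(* For nondecreasing K the difference quotients h^-1 (K (x + h) - K x) have
   integral at most K B - K A; they dominate the squared difference quotients
   of u, which tend to g^2 almost everywhere. *)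
Lemma integral_sqr_le_increment (A B : R) (u g K : R -> R) : A <= B ->
  mu.-integrable `[A, B] (EFin \o g) ->
  (forall x y, A <= x -> x <= y -> y <= B -> u y - u x = \int[mu]_(z in `[x, y]) g z) ->
  (forall x y, A <= x -> x <= y -> y <= B -> K x <= K y) ->
  (forall x y, A <= x -> x <= y -> y <= B ->
     (u y - u x) ^+ 2 <= (y - x) * (K y - K x)) ->
  (\int[mu]_(x in `[A, B]) ((g x) ^+ 2)%:E <= (K B - K A)%:E)%E.
Proof.
move=> AB ig ug ndK uK.
(* Clamping to [A, B] allows difference quotients up to B, where x + h leaves the interval: u and K
   continue as constants, hence g continues by 0. *)
pose c x := Num.max A (Num.min B x).
have cA x : A <= c x by rewrite /c le_max lexx.
have cB x : c x <= B by rewrite /c ge_max AB ge_min lexx.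
have ndc : {homo c : x y / x <= y}.
  move=> x y xy; rewrite /c ge_max !le_max lexx/= ge_min; apply/orP; right.
  by rewrite le_min ge_min lexx/= ge_min xy orbT.
have cid x : A <= x -> x <= B -> c x = x.
  by move=> Ax xB; rewrite /c min_r// max_r.
pose Kc := K \o c.
have ndKc : {homo Kc : x y / x <= y}.
  by move=> x y xy; apply: ndK => //; exact: ndc.
pose gc := g \_ `[A, B].
have igc : mu.-integrable setT (EFin \o gc).
  rewrite /gc -restrict_EFin; apply/integrable_restrict => //=.
  by rewrite setTI.
pose F x := \int[mu]_(t in `[A, x]) gc t.
have igcS (I : set R) : measurable I -> mu.-integrable I (EFin \o gc).
  by move=> mI; apply: integrableS igc.
have FB x y : A <= x -> x <= y -> F y - F x = \int[mu]_(t in `]x, y]) gc t.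
  move=> Ax xy; rewrite /F Rintegral_itvB//; exact: igcS.
have Fu x y : A <= x -> x <= y -> F y - F x = u (c y) - u (c x).
  move=> Ax xy; rewrite FB// ug//; last exact: ndc.
  rewrite -Rintegral_itv_obnd_cbnd; last first.
    by apply: integrableS ig => //; move=> z /=; rewrite !in_itv/= => /andP[/ltW xz zy];
      rewrite (le_trans _ xz)//= (le_trans zy).
  rewrite Rintegral_mkcond [RHS]Rintegral_mkcond; apply: eq_Rintegral => z _.
  rewrite /gc !patchE; case: ifPn; rewrite ?inE ?notin_setE/= in_itv/=.
    move=> /andP[xz zy]; case: ifPn; rewrite ?inE ?notin_setE/= in_itv/=.
      move=> /andP[Az zB]; rewrite ifT// inE/= in_itv/= /c.
      by rewrite gt_max gt_min le_max le_min zB zy xz (le_lt_trans Ax xz) !orbT.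
    move=> /negP; rewrite (le_trans Ax (ltW xz))/= -ltNge => Bz.
    rewrite ifF//; apply/negbTE; rewrite notin_setE/= in_itv/=.
    by move=> /andP[_]; rewrite leNgt (le_lt_trans (cB _) Bz).
  move=> xyz; rewrite ifF//; apply/negbTE; rewrite notin_setE/= in_itv/=.
  move=> /andP[cz zc]; apply: xyz.
  have zB := le_trans zc (cB y); have Az := le_lt_trans (cA x) cz.
  move: cz zc; rewrite /c gt_max le_max le_min gt_min => /andP[_ /orP[|xz]].
    by rewrite ltNge zB.
  by move=> /orP[|/andP[_ zy]]; [rewrite leNgt Az|rewrite xz zy].
(* Lebesgue differentiation gives F' = gc almost everywhere to the right of A; this is why the point
   A is discarded below. *)
have dF := @FTC1 _ gc (BLeft A) (fun y => igcS _ (measurable_itv _)) (integrable_locally (measurable_itv _) ig).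
pose q n x := (n.+1%:R * (F (n.+1%:R^-1 + x) - F x)) ^+ 2.
have cF : {within `[A, (B + 1)], continuous F}.
  apply: (@parameterized_integral_continuous _ A (B + 1) gc).
    by rewrite (le_trans AB)// lerDl.
  exact: igcS.
have mF : measurable_fun `[A, (B + 1)] F.
  by apply: subspace_continuous_measurable_fun.
have mq n : measurable_fun `[A, B] (q n).
  apply: measurable_funX; apply: measurable_funM => //.
  apply: measurable_funB; last first.
    apply: measurable_funS mF => //; apply: subset_itvl; rewrite bnd_simp.
    by rewrite lerDl.
  apply: (@measurable_comp _ _ _ _ _ _ `[A, (B + 1)]) => //.
    move=> _ /= [x /= + <-]; rewrite !in_itv/= => /andP[Ax xB].
    rewrite (le_trans Ax) ?lerDr ?invr_ge0//= addrC lerD//.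
    by rewrite invf_le1// ler1n.
  by apply: measurable_funD => //.
have qK n x : A <= x -> q n x <= n.+1%:R * (Kc (n.+1%:R^-1 + x) - Kc x).
  move=> Ax; rewrite /q exprMn Fu ?lerDr ?invr_ge0//.
  rewrite expr2 -mulrA ler_pM2l//.
  have xh : x <= n.+1%:R^-1 + x by rewrite lerDr.
  have cxx : c (n.+1%:R^-1 + x) - c x <= n.+1%:R^-1.
    have [xB|Bx] := leP x B.
      rewrite (cid x Ax xB) lerBlDr /c ge_max (le_trans Ax)//=.
      by rewrite ge_min lexx orbT.
    rewrite /c (min_l (ltW Bx)) min_l ?(le_trans (ltW Bx))// subrr.
    by rewrite invr_ge0.
  apply: (@le_trans _ _ (n.+1%:R * (n.+1%:R^-1 * (Kc (n.+1%:R^-1 + x) - Kc x)))).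
    rewrite ler_pM2l//; apply: (le_trans (uK _ _ (cA _) (ndc _ _ xh) (cB _))).
    by apply: ler_wpM2r => //; rewrite subr_ge0; exact: ndKc.
  by rewrite mulrA mulfV ?mul1r// gt_eqF.
apply: (@le_trans _ _ (\int[mu]_(x in `[A, B]) limn_einf (fun n => (q n x)%:E))%E).
  apply: ae_ge0_le_integral => //.
  - by move=> x _; rewrite lee_fin sqr_ge0.
  - apply/measurable_EFinP/measurable_funX.
    by case/integrableP: ig => /measurable_EFinP.
  - move=> x _; rewrite limn_einf_lim; apply: lime_ge.
      exact: is_cvg_einfs.
    apply: nearW => n; apply: le_ereal_inf_tmp => _ [m _ <-].
    by rewrite lee_fin sqr_ge0.
  - rewrite /limn_einf; apply: measurableT_comp => //.
    apply: measurable_fun_limn_esup => n; apply: measurableT_comp => //.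
    by move/measurable_EFinP: (mq n).
  have AB0 : {ae mu, forall x, x != A}.
    exists [set A]; split => //; first exact: lebesgue_measure_set1.
    by move=> x /= /negP; rewrite negbK => /eqP.
  move: dF AB0; apply: filterS2; first exact: (ae_filter_ringOfSetsType mu).
  move=> x dF xA; rewrite /= in_itv/= => /andP[Ax xB].
  have {}Ax : A < x by rewrite lt_neqAle eq_sym xA.
  have [dFx Fx] := dF Ax.
  have := cvg_difference_quotient dFx; rewrite Fx.
  rewrite /gc patchE mem_set/= ?in_itv/= ?(ltW Ax)// => H.
  rewrite (@cvg_limn_einf_sup _ _ ((g x) ^+ 2)%:E)//.
  by apply: cvg_EFin; [exact: nearW|exact: (continuous_cvg _ (@exprn_continuous _ 2 _) H)].
apply: le_trans.
  apply: (@fatou _ _ _ mu `[A, B] _ (fun n x => (q n x)%:E)) => //.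
  - by move=> n; by move/measurable_EFinP: (mq n).
  - by move=> n x _; rewrite lee_fin sqr_ge0.
rewrite limn_einf_lim; apply: lime_le; first exact: is_cvg_einfs.
apply: nearW => n; apply: le_trans; first by apply: ereal_inf_lbound; exists n => //=.
set h : R := n.+1%:R^-1.
have h0 : 0 < h by rewrite invr_gt0.
(* Subtracting K A makes the function nonnegative, so that the shifted integral may be enlarged to
   one starting at A. *)
pose W x := Kc x - K A.
have W0 x : 0 <= W x by rewrite subr_ge0; exact: ndK.
have WB x : W x <= K B - K A by rewrite lerB//; apply: ndK.
have mW (D : set R) : measurable D -> measurable_fun D W.
  by move=> mD; apply: measurable_funB => //; exact: nondecreasing_measurable.
have mWh : measurable_fun `[A, B] (fun x => W (h + x)).
  apply: nondecreasing_measurable => // x y xy; rewrite lerB//.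
  by apply: ndKc; rewrite lerD2l.
have iD (a b : bool) (x y : R) (f : R -> R) :
    measurable_fun [set` Interval (BSide a x) (BSide b y)] f ->
    (forall z, 0 <= f z <= K B - K A) ->
    mu.-integrable [set` Interval (BSide a x) (BSide b y)] (EFin \o f).
  move=> mf f0; apply: measurable_bounded_integrable => //.
    by rewrite /= lebesgue_measure_itv/=; case: ifP => //; rewrite -EFinD ltry.
  exists (K B - K A); split; first by rewrite num_real.
  move=> M KM z _ /=; have /andP[f1 f2] := f0 z.
  by rewrite ger0_norm// (le_trans f2)// ltW.
have iW a b x y : mu.-integrable [set` Interval (BSide a x) (BSide b y)] (EFin \o W).
  by apply: iD => [|z]; [exact: mW|rewrite W0 WB].
have iWh : mu.-integrable `[A, B] (EFin \o (fun x => W (h + x))).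
  by apply: iD => // z; rewrite W0 WB.
apply: (@le_trans _ _ (\int[mu]_(x in `[A, B]) (n.+1%:R * (W (h + x) - W x))%:E)%E).
  apply: ge0_le_integral => //.
  - by move=> x _; rewrite lee_fin sqr_ge0.
  - by move/measurable_EFinP: (mq n).
  - apply/measurable_EFinP; apply: measurable_funM => //.
    by apply: measurable_funB => //; exact: mW.
  - move=> x /=; rewrite in_itv/= => /andP[Ax xB]; rewrite lee_fin.
    by rewrite /W opprB addrA subrK qK.
have iWW : mu.-integrable `[A, B] (EFin \o (fun x => W (h + x) - W x)).
  rewrite (_ : _ \o _ = (EFin \o (fun x => W (h + x)%R)) \- (EFin \o W))%E//.
  exact: integrableB.
have iWWn : mu.-integrable `[A, B] (EFin \o (fun x => n.+1%:R * (W (h + x) - W x))).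
  rewrite (_ : _ \o _ = (fun x => n.+1%:R%:E * (EFin \o (fun x => (W (h + x) - W x)%R)) x)%E)//.
  exact: integrableZl.
rewrite -[X in (X <= _)%E]fineK; last exact: integrable_fin_num iWWn.
rewrite lee_fin -/(Rintegral mu `[A, B]%classic _).
rewrite RintegralZl// RintegralB//.
have -> : \int[mu]_(x in `[A, B]) W (h + x) = \int[mu]_(x in `[(h + A), (h + B)]) W x.
  rewrite /Rintegral -(@ge0_integral_shift _ h _ (EFin \o W))//.
  - congr (fine (integral _ _ _)); apply/seteqP.
    by split => x /=; rewrite !in_itv/= !lerD2l.
  - by apply/measurable_EFinP; exact: mW.
  - by move=> x _; rewrite lee_fin.
have hn : n.+1%:R * h = 1 by rewrite mulfV.
rewrite -(ler_pM2l h0) mulrA [h * _]mulrC hn mul1r lerBlDr.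
apply: (@le_trans _ _ (\int[mu]_(x in `[A, (h + B)]) W x)).
  rewrite /Rintegral fine_le//.
  - exact: integrable_fin_num (iW _ _ _ _).
  - exact: integrable_fin_num (iW _ _ _ _).
  apply: ge0_subset_integral => //.
  - by apply/measurable_EFinP; exact: mW.
  - by move=> x _; rewrite lee_fin.
  - by apply: subset_itvr; rewrite bnd_simp lerDr ltW.
have Ah : mu.-integrable `[A, (h + B)] (EFin \o W) by [].
have := Rintegral_itvB Ah; move=> /(_ B); rewrite !bnd_simp AB lerDr (ltW h0).
move=> /(_ isT isT)/eqP; rewrite subr_eq => /eqP ->; rewrite lerD2r.
(* The integrals over [A, B] have cancelled; what remains is a strip of length h, on which W is at
   most K B - K A. *)
apply: (@le_trans _ _ (\int[mu]_(x in `]B, (h + B)]) (K B - K A))).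
  apply: le_Rintegral => //; apply: iD => // z.
  by rewrite subr_ge0 ndK//=.
rewrite Rintegral_cst//= lebesgue_measure_itv/= lte_fin ltrDr h0 -EFinD/=.
by rewrite addrK mulrC.
Qed.

End DifferenceQuotient.

(** * Absolute continuity through Stieltjes measures *)

Section StieltjesDensity.
Context {R : realType}.
Notation mu := (@lebesgue_measure R).
Notation lsm := (@lebesgue_stieltjes_measure R).
Implicit Types F G H : cumulative R R.

Lemma lebesgue_stieltjes_measure_ocitv F (a b : R) : a <= b ->
  lsm F `]a, b]%classic = (F b - F a)%:E.
Proof.
move=> ab; rewrite /lebesgue_stieltjes_measure /measure_extension.
by rewrite measurable_mu_extE/=; [exact: wlength_itv_bnd|exact: is_ocitv].
Qed.

Lemma lebesgue_stieltjes_measureD F G H (A : set R) :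
  (forall x, H x = F x + G x) -> measurable A ->
  lsm H A = (lsm F A + lsm G A)%E.
Proof.
move=> HFG mA; rewrite -measure_addE.
apply: lebesgue_stieltjes_measure_unique => // X [[a b] _ <-]/=.
have [ab|ba] := leP a b; last by rewrite set_itv_ge ?bnd_simp -?leNgt ?(ltW ba)// !measure0.
rewrite [RHS]measure_addE lebesgue_stieltjes_measure_ocitv//.
transitivity ((F b - F a)%:E + (G b - G a)%:E)%E.
  by rewrite -EFinD !HFG; congr (_%:E); ring.
by congr (_ + _)%E; apply/esym; exact: lebesgue_stieltjes_measure_ocitv.
Qed.

(** By the increment hypothesis G - F is nondecreasing, hence itself a cumulative function, and the
    measure of G is a sum of two measures. *)
Lemma le_lebesgue_stieltjes_measure F G (A : set R) :
  (forall x y, x <= y -> F y - F x <= G y - G x) -> measurable A ->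
  (lsm F A <= lsm G A)%E.
Proof.
move=> FG mA; pose d x := G x - F x.
have nd : nondecreasing d.
  by move=> x y xy; rewrite /d; have := FG _ _ xy; lra.
have rc : right_continuous d.
  by move=> x; apply: cvgB; exact: cumulative_is_right_continuous.
pose D : cumulative R R := HB.pack d (isCumulative.Build R _ R d nd rc).
rewrite (@lebesgue_stieltjes_measureD F D G)//; last first.
  by move=> x; rewrite /D/= /d addrC subrK.
by rewrite leeDl.
Qed.

Lemma lebesgue_stieltjes_measureT_le F (C : R) :
  (forall x y, x <= y -> F y - F x <= C) -> (lsm F setT <= C%:E)%E.
Proof.
move=> FC; rewrite -(bigcup_itvT false false).
have : (lsm F \o (fun n => `]- n%:R, n%:R]%classic)) n @[n --> \oo] -->
    lsm F (\bigcup_n `]- n%:R, n%:R]%classic).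
  apply: nondecreasing_cvg_mu => //; first exact: bigcup_measurable.
  by move=> *; apply/subsetPset/subset_itv; rewrite leBSide/= ?lerN2 ler_nat.
move=> /cvg_lim <- //; apply: lime_le.
  apply: ereal_nondecreasing_is_cvgn => m n mn; apply: le_measure; rewrite ?inE//.
  by apply/subset_itv; rewrite leBSide/= ?lerN2 ler_nat.
have n0 n : - n%:R <= n%:R :> R by rewrite (@le_trans _ _ 0)// oppr_le0.
by apply: nearW => n /=; rewrite lebesgue_stieltjes_measure_ocitv// lee_fin FC.
Qed.

Lemma null_lebesgue_stieltjes_measure_linear F (c : R) (A : set R) : 0 <= c ->
  (forall x, F x = c * x) -> measurable A -> mu A = 0%E -> lsm F A = 0%E.
Proof.
move=> c0 Fc mA A0.
rewrite (@lebesgue_stieltjes_measure_unique _ F (mscale (NngNum c0) mu))//.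
  by transitivity (c%:E * mu A)%E => //; rewrite A0 mule0.
move=> X [[a b] _ <-]/=.
have [ab|ba] := leP a b; last by rewrite set_itv_ge ?bnd_simp -?leNgt ?(ltW ba)// !measure0.
rewrite lebesgue_stieltjes_measure_ocitv// !Fc.
transitivity (c%:E * mu `]a, b]%classic)%E => //.
rewrite lebesgue_measure_itv/= lte_fin.
case: ltP => [_|ba]; first by rewrite -EFinD -EFinM mulrBr.
by rewrite mule0 (@le_anti _ _ a b) ?ab ?ba// subrr.
Qed.

Lemma density_of_dominated F : lsm F `<< mu -> (lsm F setT < +oo)%E ->
  exists f : R -> R, [/\ forall x, 0 <= f x, mu.-integrable setT (EFin \o f)
    & forall x y, x <= y -> F y - F x = \int[mu]_(z in `[x, y]) f z].
Proof.
move=> Fmu FT; pose nu := mfrestr measurableT FT.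
have nuE A : nu A = lsm F A by rewrite /nu/= /mfrestr/= /mrestr setIT.
have [|f [f0 ff intf fE]] := @radon_nikodym_sigma_finite _ _ _ mu nu.
  apply/null_content_dominatesP => A mA muA; rewrite [LHS]nuE.
  by move/null_content_dominatesP: Fmu; apply.
have fEF : f = EFin \o (fine \o f).
  by apply/funext => x /=; rewrite fineK.
exists (fine \o f); rewrite -fEF; split => //.
  by move=> x; rewrite fine_ge0.
move=> x y xy.
have : lsm F `]x, y]%classic = (\int[mu]_(z in `]x, y]) f z)%E.
  by rewrite -nuE; exact: fE.
rewrite lebesgue_stieltjes_measure_ocitv// => e.
rewrite -Rintegral_itv_obnd_cbnd; last first.
  by rewrite -fEF; apply: integrableS intf.
by rewrite -[LHS]/(fine (F y - F x)%:E) e /Rintegral fEF.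
Qed.

(** K is only known to be monotone, whereas a Stieltjes measure is built from a right-continuous
    function: the infimum of K over ]x, +oo[, its right limit, takes its place. *)
Lemma nondecreasing_right_regularization (K : R -> R) (M : R) :
  {homo K : x y / x <= y} -> (forall x y, x <= y -> K y - K x <= M) ->
  exists F, (forall x y, x < y -> F x <= K y) /\ (forall x, K x <= F x).
Proof.
move=> ndK KM; pose k x := inf [set K y | y in `]x, +oo[%classic].
have ne x : [set K y | y in `]x, +oo[%classic] !=set0.
  by exists (K (x + 1)), (x + 1) => //=; rewrite in_itv/= ltrDl ltr01.
have lb x : lbound [set K y | y in `]x, +oo[%classic] (K x).
  by move=> _ [y /= + <-]; rewrite in_itv/= andbT => /ltW; exact: ndK.
have kK x y : x < y -> k x <= K y.
  by move=> xy; apply: ge_inf; [exists (K x)|exists y => //=; rewrite in_itv/= xy].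
have nd : nondecreasing k.
  move=> x y xy; apply: lb_le_inf => // _ [z /= + <-]; rewrite in_itv/= andbT => yz.
  by apply: kK; exact: le_lt_trans yz.
have rc : right_continuous k.
  move=> x; apply/cvgrPdist_le => e e0.
  have [|_ [y /= + <-] Ky] := @inf_adherent _ [set K y | y in `]x, +oo[%classic] e e0.
    by split => //; exists (K x).
  rewrite in_itv/= andbT => xy; near=> z.
  have xz : x < z by near: z; exact: nbhs_right_gt.
  have zy : z < y by near: z; exact: nbhs_right_lt.
  have kxz := nd _ _ (ltW xz).
  rewrite ler0_norm ?subr_le0// opprB.
  by rewrite lerBlDl -/(k x) (le_trans (kK _ _ zy))// ltW// addrC.
pose F : cumulative R R := HB.pack k (isCumulative.Build R _ R k nd rc).
exists F; split => //= x.
by apply: lb_le_inf.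
Unshelve. all: by end_near. Qed.

Lemma continuous_of_sqr_increment (D : set R) (C : R) (u : R -> R) :
  (forall x y, D x -> D y -> x <= y -> (u y - u x) ^+ 2 <= (y - x) * C) ->
  {within D, continuous u}.
Proof.
move=> uC; apply/subspace_continuousP => x Dx; apply/cvgrPdist_le => e e0.
have C0 : 0 < `|C| + 1 by rewrite ltr_wpDl.
rewrite near_withinE; near=> y => Dy.
have xy : `|x - y| < e ^+ 2 / (`|C| + 1).
  by near: y; apply: nbhsx_ballx; rewrite divr_gt0// exprn_gt0.
have {}xy : `|x - y| * C <= e ^+ 2.
  rewrite (@le_trans _ _ (`|x - y| * (`|C| + 1)))//.
    by rewrite ler_wpM2l// (le_trans (ler_norm _))// lerDl.
  by rewrite -ler_pdivlMr// ltW.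
rewrite -(@ler_pXn2r _ 2)// ?nnegrE ?(ltW e0)// real_normK ?num_real//.
apply: le_trans xy; have [xy|/ltW yx] := leP x y.
  by rewrite distrC ger0_norm ?subr_ge0// -sqrrN opprB uC.
by rewrite ger0_norm ?subr_ge0// uC.
Unshelve. all: by end_near. Qed.

(** On a null set the linear part of the AM-GM bound has measure 0 and the other part has total mass
    at most e. As e is arbitrary, the Stieltjes measure of u is absolutely continuous, and
    Radon-Nikodym provides f. *)
Lemma density_of_sqr_increment (u K : R -> R) (M : R) :
  {homo u : x y / x <= y} -> {homo K : x y / x <= y} ->
  (forall x y, x <= y -> u y - u x <= M) ->
  (forall x y, x <= y -> K y - K x <= M) ->
  (forall x y, x <= y -> (u y - u x) ^+ 2 <= (y - x) * (K y - K x)) ->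
  exists f : R -> R, [/\ forall x, 0 <= f x, mu.-integrable setT (EFin \o f)
    & forall x y, x <= y -> u y - u x = \int[mu]_(z in `[x, y]) f z].
Proof.
move=> ndu ndK uM KM uK.
have M0 : 0 <= M by have := uM 0 0 (lexx _); rewrite subrr.
have cu : continuous u.
  apply/continuous_subspace_setT/(@continuous_of_sqr_increment setT M) => x y _ _ xy.
  by rewrite (le_trans (uK _ _ xy))// ler_wpM2l ?subr_ge0// KM.
have rcu : right_continuous u.
  by move=> x; apply: cvg_at_right_filter; exact: cu.
pose F : cumulative R R := HB.pack u (isCumulative.Build R _ R u ndu rcu).
have [G [GK KG]] := nondecreasing_right_regularization ndK KM.
apply: (@density_of_dominated F); last first.
  by rewrite (le_lt_trans (@lebesgue_stieltjes_measureT_le F M _))// ltry.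
apply/null_content_dominatesP => A mA A0.
apply/eqP; rewrite eq_le measure_ge0 andbT; apply/lee_addgt0Pr => e e0; rewrite add0e.
(* AM-GM: [du <= d dK + dx / (4 d)] with [d M <= e]. *)
pose d := e / (M + 1).
have M1 : 0 < M + 1 by rewrite ltr_wpDl.
have d0 : 0 < d by rewrite divr_gt0.
pose c := (4 * d)^-1.
have c0 : 0 < c by rewrite invr_gt0 mulr_gt0.
have dc : 4 * d * c = 1 by rewrite mulfV// gt_eqF// mulr_gt0.
pose lc x := c * x.
have ndl : nondecreasing lc by move=> x y xy; rewrite /lc ler_pM2l.
have rcl : right_continuous lc.
  by move=> x; apply: cvg_at_right_filter; exact: mulrl_continuous.
pose L : cumulative R R := HB.pack lc (isCumulative.Build R _ R lc ndl rcl).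
pose kd x := d * G x.
have ndkd : nondecreasing kd.
  by move=> x y xy; rewrite /kd ler_pM2l//; exact: cumulative_is_nondecreasing.
have rckd : right_continuous kd.
  by move=> x; apply: cvgMr; exact: cumulative_is_right_continuous.
pose D : cumulative R R := HB.pack kd (isCumulative.Build R _ R kd ndkd rckd).
pose s x := kd x + lc x.
have nds : nondecreasing s by move=> x y xy; rewrite /s lerD ?ndkd ?ndl.
have rcs : right_continuous s by move=> x; apply: cvgD; [exact: rckd|exact: rcl].
pose S : cumulative R R := HB.pack s (isCumulative.Build R _ R s nds rcs).
apply: (@le_trans _ _ (lsm S A)).
  apply: le_lebesgue_stieltjes_measure => // x y xy; rewrite /S /F/=.
  (* K lies between values of G only up to a shift, so the bound is proved between x + t and y + t.
     Right continuity costs r / (d + 1) once for u and, multiplied by d, once for G: in total r. *)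
  have uG : u y - u x <= d * (G y - G x) + c * (y - x).
    apply/ler_addgt0Pr => r r0.
    have r1 : 0 < r / (d + 1) by rewrite divr_gt0// addr_gt0.
    have [d1 Gd1] := nondecreasing_right_continuousP y G r1.
    have [d2 Fd2] := nondecreasing_right_continuousP x F r1.
    pose t := Num.min d1%:num d2%:num.
    have t0 : 0 < t by rewrite lt_min !gt0.
    have Gt : G (y + t) <= G y + r / (d + 1).
      by rewrite (le_trans _ Gd1)// cumulative_is_nondecreasing// lerD2l ge_min lexx.
    have ut : u (x + t) <= u x + r / (d + 1).
      by rewrite (le_trans _ Fd2)// ndu// lerD2l ge_min lexx orbT.
    have xyt : x + t <= y + t by rewrite lerD2r.
    have := KG (y + t); have := GK x (x + t); rewrite ltrDl => /(_ t0).
    have : u (y + t) - u (x + t) <= d * (K (y + t) - K (x + t)) + c * (y - x).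
      have k0 : 0 <= K (y + t) - K (x + t) by rewrite subr_ge0 ndK.
      have := uK _ _ xyt; rewrite (_ : y + t - (x + t) = y - x); last by ring.
      move=> uKt; have u0 : 0 <= u (y + t) - u (x + t) by rewrite subr_ge0 ndu.
      have s0 : 0 <= d * (K (y + t) - K (x + t)) + c * (y - x).
        by rewrite addr_ge0// mulr_ge0 ?subr_ge0 ?(ltW d0) ?(ltW c0)// ndK.
      rewrite -(@ler_pXn2r _ 2) ?nnegrE//.
      apply: le_trans uKt _.
      set k := K _ - _; rewrite (_ : (d * k + c * (y - x)) ^+ 2 =
        (d * k - c * (y - x)) ^+ 2 + 4 * d * c * ((y - x) * k)); last by ring.
      by rewrite dc mul1r lerDr sqr_ge0.
    have : u y <= u (y + t) by rewrite ndu// lerDl ltW.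
    have : d * (r / (d + 1)) + r / (d + 1) = r.
      by rewrite -{2}(mul1r (r / _)) -mulrDl mulrC mulfVK// gt_eqF// addr_gt0.
    move: (K (y + t)) (K (x + t)) (G (y + t)) Gt => Ky Kx Gy Gt.
    have dG a b : a <= b -> d * a <= d * b by move=> ab; rewrite ler_pM2l.
    move=> e1 e2 e3 e4 e5.
    have := dG _ _ e4; have := dG _ _ e5; have := dG _ _ Gt.
    move: e1 e2 e3 ut; lra.
  by move: uG; rewrite /s /kd /lc; lra.
rewrite (@lebesgue_stieltjes_measureD D L S)// [X in (_ + X)%E](@null_lebesgue_stieltjes_measure_linear _ c)//; last exact: ltW.
rewrite adde0 (@le_trans _ _ (lsm D setT))//.
  by apply: le_measure; rewrite ?inE.
apply: lebesgue_stieltjes_measureT_le => x y xy; rewrite /D/= /kd -mulrBr.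
have GM : G y - G x <= M.
  apply/ler_addgt0Pr => r r0.
  have := GK y (y + r); rewrite ltrDl => /(_ r0).
  have := KG x; have := KM x (y + r).
  have xyr : x <= y + r by rewrite (le_trans xy)// lerDl ltW.
  move=> /(_ xyr); lra.
rewrite (@le_trans _ _ (d * (M + 1)))//; first by rewrite ler_pM2l//; lra.
by rewrite /d mulfVK// gt_eqF.
Qed.

End StieltjesDensity.

(** * Weak derivatives and primitives on an interval *)

Section IntegrationByParts.
Context {R : realType}.
Notation mu := (@lebesgue_measure R).
Implicit Types (D : set R) (u g eta : R -> R).

Definition C1 eta := (forall x, derivable eta x 1) /\ continuous (derive1 eta).

Lemma integrable_continuous_itv (A B : R) u : {within `[A, B], continuous u} ->
  mu.-integrable `[A, B] (EFin \o u).
Proof. by move=> cu; apply: continuous_compact_integrable => //; exact: segment_compact. Qed.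

Lemma Rintegral_derive1 eta (A B : R) : C1 eta -> A <= B ->
  \int[mu]_(x in `[A, B]) derive1 eta x = eta B - eta A.
Proof.
move=> [deta ceta]; rewrite le_eqVlt => /predU1P[->|AB].
  by rewrite set_itv1 Rintegral_set1 subrr.
have cont x : {for x, continuous eta}.
  by apply: differentiable_continuous; apply/derivable1_diffP.
have ce : {within `[A, B], continuous (derive1 eta)} by exact: continuous_subspaceT.
have de : derivable_oo_LRcontinuous eta A B.
  split; first by move=> x _; exact: deta.
  - by apply: cvg_at_right_filter; exact: cont.
  - by apply: cvg_at_left_filter; exact: cont.
by rewrite /Rintegral (continuous_FTC2 AB ce de (fun x _ => erefl _)).
Qed.

(** Fubini for eta'(x) g(y) on the triangle A <= y <= x <= B: integrating in y first gives eta' (u -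
    u A), integrating in x first gives g (eta B - eta) = - g eta. The constant u A drops out since
    eta' has integral 0. *)
Lemma Rintegral_by_parts_primitive (A B : R) u g eta : A <= B -> C1 eta ->
  eta A = 0 -> eta B = 0 -> mu.-integrable `[A, B] (EFin \o g) ->
  (forall x, A <= x -> x <= B -> u x - u A = \int[mu]_(z in `[A, x]) g z) ->
  \int[mu]_(x in `[A, B]) (u x * derive1 eta x) =
  - \int[mu]_(x in `[A, B]) (g x * eta x).
Proof.
move=> AB Ceta eA eB ig ug.
have [deta ceta] := Ceta.
have cont : continuous eta.
  by move=> x; apply: differentiable_continuous; apply/derivable1_diffP.
have ie : mu.-integrable `[A, B] (EFin \o derive1 eta).
  by apply: integrable_continuous_itv; exact: continuous_subspaceT.
pose e := derive1 eta \_ `[A, B]; pose gX := g \_ `[A, B].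
have integrableX f : mu.-integrable `[A, B] (EFin \o f) ->
    mu.-integrable setT (EFin \o (f \_ `[A, B])).
  by move=> iF; rewrite -restrict_EFin; apply/integrable_restrict => //=; rewrite setTI.
have iE : mu.-integrable setT (EFin \o e) by exact: integrableX.
have igX : mu.-integrable setT (EFin \o gX) by exact: integrableX.
have inX x : x \in `[A, B]%classic = (A <= x <= B).
  by apply/idP/idP; rewrite inE/= in_itv.
pose h (p : R * R) : R := if p.2 <= p.1 then e p.1 * gX p.2 else 0.
have mh : measurable_fun setT h.
  apply: measurable_fun_ifT => //; first exact: measurable_fun_ler.
  apply: measurable_funM.
  - apply: measurableT_comp => //.
    by case/integrableP: iE => /measurable_EFinP.
  - apply: measurableT_comp => //.
    by case/integrableP: igX => /measurable_EFinP.
have hx x y : h (x, y) = e x * (g \_ `[A, x]) y.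
  rewrite /h/= /gX /e !patchE inX.
  case: ifPn => [yx|]; last first.
    rewrite -ltNge => xy; rewrite [y \in `[A, x]%classic](_ : _ = false) ?mulr0//.
    by apply/negP; rewrite inE/= in_itv/= => /andP[_]; rewrite leNgt xy.
  case: ifPn => [/andP[Ax xB]|_]; last by rewrite !mul0r.
  rewrite inX (le_trans yx xB) andbT.
  have -> : (y \in `[A, x]%classic) = (A <= y).
    apply/idP/idP; rewrite inE/= in_itv/=; first by case/andP.
    by move=> ->; rewrite yx.
  by [].
have hy x y : h (x, y) = gX y * (derive1 eta \_ `[y, B]) x.
  rewrite /h/= /gX /e !patchE inX.
  case: ifPn => [yx|]; last first.
    rewrite -ltNge => xy; rewrite [x \in `[y, B]%classic](_ : _ = false) ?mulr0//.
    by apply/negP; rewrite inE/= in_itv/= => /andP[]; rewrite leNgt xy.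
  rewrite inX; case: (boolP (A <= y <= B)) => [/andP[Ay yB]|_]; last by rewrite !mulr0 mul0r.
  rewrite (le_trans Ay yx)/=.
  have -> : (x \in `[y, B]%classic) = (x <= B).
    apply/idP/idP; rewrite inE/= in_itv/=; first by case/andP.
    by move=> ->; rewrite yx.
  by rewrite mulrC; case: ifP; rewrite ?mulr0 ?mul0r.
have igx x : x <= B -> mu.-integrable setT (EFin \o (g \_ `[A, x])).
  move=> xB; rewrite -restrict_EFin; apply/integrable_restrict => //=; rewrite setTI.
  apply: integrableS ig => //; exact: subset_itvl.
have iex y : A <= y -> mu.-integrable setT (EFin \o (derive1 eta \_ `[y, B])).
  move=> Ay; rewrite -restrict_EFin; apply/integrable_restrict => //=; rewrite setTI.
  apply: integrableS ie => //; exact: subset_itvr.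
have I1 x : (\int[mu]_y (h (x, y))%:E = (e x * (u x - u A))%:E)%E.
  under eq_integral do rewrite hx EFinM.
  have [|xX] := boolP (x \in `[A, B]%classic); last first.
    have -> : e x = 0 by rewrite /e patchE (negbTE xX).
    by rewrite mul0r; apply: integral0_eq => y _; rewrite mul0e.
  rewrite inX => /andP[Ax xB].
  rewrite integralZl//; last exact: igx.
  rewrite EFinM ug// Rintegral_mkcond /Rintegral fineK//.
  exact: integrable_fin_num (igx _ xB).
have I2 y : (\int[mu]_x (h (x, y))%:E = (- (gX y * eta y))%:E)%E.
  under eq_integral do rewrite hy EFinM.
  have [|yX] := boolP (y \in `[A, B]%classic); last first.
    have -> : gX y = 0 by rewrite /gX patchE (negbTE yX).
    by rewrite mul0r oppr0; apply: integral0_eq => x _; rewrite mul0e.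
  rewrite inX => /andP[Ay yB].
  rewrite integralZl//; last exact: iex.
  rewrite -mulrN EFinM -[- eta y]add0r -eB -(Rintegral_derive1 Ceta yB).
  rewrite Rintegral_mkcond /Rintegral fineK//.
  exact: integrable_fin_num (iex _ Ay).
have ih : (mu \x mu)%E.-integrable setT (EFin \o h).
  apply/integrable12ltyP => /=; first exact/measurable_EFinP.
  pose C := (\int[mu]_y `|(gX y)%:E|)%E.
  have C0 : (0 <= C)%E by exact: integral_ge0.
  have Cfin : C \is a fin_num.
    by rewrite ge0_fin_numE//; case/integrableP: igX.
  apply: (@le_lt_trans _ _ (\int[mu]_x (C * `|(e x)%:E|))%E).
    apply: ge0_le_integral => //.
    - by move=> x _; exact: integral_ge0.
    - apply: (@measurable_fun_fubini_tonelli_F _ _ (measurableTypeR R)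
        (measurableTypeR R) R mu (abse \o (EFin \o h))).
        by apply: measurableT_comp => //; apply/measurable_EFinP.
      by move=> p; exact: abse_ge0.
    - apply: measurable_funeM; apply: measurableT_comp => //.
      by case/integrableP: iE.
    move=> x _; rewrite muleC /C -ge0_integralZl//; last first.
      by apply: measurableT_comp => //; case/integrableP: igX.
    apply: ge0_le_integral => //.
    - apply/measurable_EFinP; apply: measurableT_comp => //.
      by apply: (measurableT_comp mh); exact: pair1_measurable.
    - apply: measurable_funeM; apply: measurableT_comp => //.
      by case/integrableP: igX.
    move=> y _; rewrite -abseM -EFinM !abse_EFin lee_fin /h/=.
    by case: ifP => // _; rewrite normr0.
  rewrite ge0_integralZl//; last first.
    by apply: measurableT_comp => //; case/integrableP: iE.
  by apply: lte_mul_pinfty => //; case/integrableP: iE.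
have := Fubini ih.
under eq_integral do rewrite I1.
under [X in _ = X -> _]eq_integral do rewrite I2.
move=> /(congr1 fine) H.
(* v equals u - u A on [A, B] and is continuous as a parameterized integral, which makes its product
   with eta' integrable. *)
pose v x := parameterized_integral mu A x g.
have iv : mu.-integrable `[A, B] (EFin \o (fun x => v x * derive1 eta x)).
  apply: integrable_continuous_itv; apply/subspace_continuousP => x Dx; apply: cvgM.
    have /subspace_continuousP := parameterized_integral_continuous AB ig.
    exact.
  by apply: cvg_within_filter; exact: ceta.
have -> : \int[mu]_(x in `[A, B]) (u x * derive1 eta x) =
    \int[mu]_(x in `[A, B]) (u A * derive1 eta x + v x * derive1 eta x).
  apply: eq_Rintegral => x; rewrite inX => /andP[Ax xB].
  by rewrite -mulrDl /v /parameterized_integral -ug// subrKC.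
rewrite RintegralD//; last first.
  rewrite (_ : _ \o _ = (fun x => (u A)%:E * (EFin \o derive1 eta) x)%E)//.
  exact: integrableZl.
rewrite RintegralZl// Rintegral_derive1// eA eB subrr mulr0 add0r.
move: H; rewrite -!/(Rintegral mu setT _) => H.
transitivity (\int[mu]_x (e x * (u x - u A))).
  rewrite Rintegral_mkcond; apply: eq_Rintegral => x _.
  rewrite /e !patchE inX; case: ifPn => [/andP[Ax xB]|]; last by rewrite mul0r.
  by rewrite mulrC ug.
rewrite H; under eq_Rintegral do rewrite -mulN1r.
rewrite RintegralZl ?mulN1r//; last first.
  rewrite (_ : _ \o _ = (EFin \o ((fun y => g y * eta y) \_ `[A, B]))); last first.
    by apply/funext => y /=; rewrite /gX !patchE; case: ifP; rewrite ?mul0r.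
  apply: integrableX.
  rewrite (_ : _ \o _ = ((EFin \o g) \* (EFin \o eta))%E); last first.
    by apply/funext => y /=; rewrite EFinM.
  apply: integrableMl => //.
    by apply: measurable_funTS; exact: continuous_measurable_fun.
  have [c _ cmax] := EVT_max AB (continuous_subspaceT (fun x => cvg_norm (cont x))).
  exists `|eta c|; split; first by rewrite num_real.
  move=> M cM x xX; apply: (le_trans _ (ltW cM)).
  by apply: cmax; move: xX; rewrite /= in_itv.
congr (- _); rewrite [RHS]Rintegral_mkcond; apply: eq_Rintegral => y _.
by rewrite /gX !patchE; case: ifP; rewrite ?mul0r.
Qed.
End IntegrationByParts.

(** * The du Bois-Reymond lemma with explicit test functions *)

Section DuBoisReymond.
Context {R : realType}.
Notation mu := (@lebesgue_measure R).

(** At the kink z = a the difference quotient is |h|, which tends to 0. *)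
Lemma is_derive_mulr_normr (a z : R) :
  is_derive z 1 (fun z => (z - a) * `|z - a|) (2 * `|z - a|).
Proof.
have [za|az|->] := ltgtP z a.
- apply: (@near_eq_is_derive _ _ _ (fun z => - (z - a) ^+ 2)).
    near=> y; have ya : y < a by near: y; exact: lt_nbhsl.
    by rewrite ltr0_norm ?subr_lt0// expr2 mulrN.
  apply: is_derive_eq; rewrite ltr0_norm ?subr_lt0//.
  by rewrite /GRing.scale/=; ring.
- apply: (@near_eq_is_derive _ _ _ (fun z => (z - a) ^+ 2)).
    near=> y; have ay : a < y by near: y; exact: lt_nbhsr.
    by rewrite gtr0_norm ?subr_gt0// expr2.
  apply: is_derive_eq; rewrite gtr0_norm ?subr_gt0//.
  by rewrite /GRing.scale/=; ring.
rewrite subrr normr0 mulr0.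
suff H : (fun h => h^-1 *: (((fun z => (z - a) * `|z - a|) \o shift a) (h *: 1) -
    (fun z => (z - a) * `|z - a|) a)) @ (0 : R)^' --> (0 : R).
  by apply: DeriveDef; [apply/cvg_ex; exists 0|exact/cvg_lim].
have N0 : (fun h : R => `|h|) @ (0 : R)^' --> (0 : R).
  rewrite -[X in _ --> X](normr0 R); apply: cvg_within_filter; exact: norm_continuous.
apply: cvg_trans N0; apply: near_eq_cvg; near=> h.
rewrite /= subrr mul0r subr0 /GRing.scale/= mulr1 addrK mulrA mulVf ?mul1r//.
by near: h; exact: nbhs_dnbhs_neq.
Unshelve. all: by end_near. Qed.

(** A second difference of z |z|: a C^1 transition from 0 on the left of a to 1 on the right of a +
    2 d, in one formula without cases. *)
Definition quadratic_step (a d z : R) := 2^-1 +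
  ((z - a) * `|z - a| - 2 * ((z - (a + d)) * `|z - (a + d)|) +
   (z - (a + 2 * d)) * `|z - (a + 2 * d)|) / (4 * d ^+ 2).

(** The tent of integral 1 on [a, a + 2 d], written as a second difference of |z|; it is the
    derivative of [quadratic_step] and serves as an averaging kernel. *)
Definition hat (a d z : R) :=
  (`|z - a| - 2 * `|z - (a + d)| + `|z - (a + 2 * d)|) / (2 * d ^+ 2).

Lemma is_derive_quadratic_step (a d z : R) : d != 0 ->
  is_derive z 1 (quadratic_step a d) (hat a d z).
Proof.
move=> d0; rewrite /quadratic_step /hat.
have d1 := is_derive_mulr_normr a z.
have d2 := is_derive_mulr_normr (a + d) z.
have d3 := is_derive_mulr_normr (a + 2 * d) z.
apply: is_derive_eq; rewrite /GRing.scale/=.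
by field.
Qed.

Lemma continuous_hat (a d : R) : continuous (hat a d).
Proof.
have cn b : continuous (fun z : R => `|z - b|).
  by move=> z; apply: cvg_norm; apply: cvgB => //; exact: cvg_cst.
move=> z; apply: cvgM; last exact: cvg_cst.
apply: cvgD; last exact: cn.
apply: cvgB; first exact: cn.
by apply: cvgM; [exact: cvg_cst|exact: cn].
Qed.

Lemma hat_ge0 (a d z : R) : 0 < d -> 0 <= hat a d z.
Proof.
move=> d0; rewrite /hat divr_ge0//; last by rewrite mulr_ge0// sqr_ge0.
have [?|?] := ger0P (z - a); have [?|?] := ger0P (z - (a + d));
  have [?|?] := ger0P (z - (a + 2 * d)); lra.
Qed.

Lemma hat_eq0 (a d z : R) : 0 < d -> ~~ (a <= z <= a + 2 * d) -> hat a d z = 0.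
Proof.
move=> d0; rewrite negb_and -!ltNge => /orP[] H; rewrite /hat.
  by rewrite !ltr0_norm; [rewrite [X in X / _](_ : _ = 0) ?mul0r//; ring|lra..].
by rewrite !gtr0_norm; [rewrite [X in X / _](_ : _ = 0) ?mul0r//; ring|lra..].
Qed.

Lemma quadratic_step_eq0 (a d z : R) : 0 < d -> z <= a -> quadratic_step a d z = 0.
Proof.
move=> d0 za; rewrite /quadratic_step !ler0_norm; [|lra..].
by field; rewrite gt_eqF.
Qed.

Lemma quadratic_step_eq1 (a d z : R) : 0 < d -> a + 2 * d <= z -> quadratic_step a d z = 1.
Proof.
move=> d0 za; rewrite /quadratic_step !ger0_norm; [|lra..].
by field; rewrite gt_eqF.
Qed.

Lemma C1_quadratic_step (a d : R) : 0 < d -> C1 (quadratic_step a d).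
Proof.
move=> d0; have H z := @is_derive_quadratic_step a d z (lt0r_neq0 d0).
split; first by move=> z; have [] := H z.
rewrite (_ : derive1 _ = hat a d); first exact: continuous_hat.
by apply/funext => z; rewrite derive1E derive_val.
Qed.

Lemma derive1_quadratic_step (a d : R) : 0 < d -> derive1 (quadratic_step a d) = hat a d.
Proof.
move=> d0; have H z := @is_derive_quadratic_step a d z (lt0r_neq0 d0).
by apply/funext => z; rewrite derive1E derive_val.
Qed.

Lemma C1B (f g : R -> R) : C1 f -> C1 g ->
  C1 (f \- g) /\ derive1 (f \- g) = derive1 f \- derive1 g.
Proof.
move=> [df cf] [dg cg].
have E : derive1 (f \- g) = derive1 f \- derive1 g.
  by apply/funext => x; rewrite /= !derive1E deriveB.
split => //; split; first by move=> x; apply: derivableB.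
by rewrite E => x; apply: cvgB; [exact: cf|exact: cg].
Qed.

(** If w x < w y inside the interval, test with the difference of two steps starting at x and y: its
    derivative compares averages of w near x and near y, which orthogonality forces to be equal. So
    w is constant on ]A, B[, and continuity reaches the endpoints. *)
Lemma endpoint_eq_of_orthogonal (A B : R) (w : R -> R) : A < B ->
  {within `[A, B], continuous w} ->
  (forall eta a b, A < a -> a <= b -> b < B -> C1 eta ->
     (forall z, ~~ (a <= z <= b) -> eta z = 0) ->
     \int[mu]_(x in `[A, B]) (w x * derive1 eta x) = 0) ->
  w A = w B.
Proof.
move=> AB cw w0; have /(continuous_within_itvP _ AB) [cwi cwA cwB] := cw.
have step x y : A < x -> x < B -> A < y -> y < B -> ~ (w x < w y).
  (* A third of the gap, so that w x + e < w y - e still separates the two averages. *)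
  move=> Ax xB Ay yB xy; pose e := (w y - w x) / 3.
  have e0 : 0 < e by rewrite divr_gt0// subr_gt0.
  have ball_at z : A < z -> z < B -> exists2 r : R, 0 < r &
      forall t, `|z - t| < r -> `|w z - w t| <= e.
    move=> Az zB; have zAB : z \in `]A, B[ by rewrite in_itv/= Az zB.
    have /cvgrPdist_le /(_ _ e0) /nbhs_ballP[r /= r0 rb] := cwi z zAB.
    by exists r.
  have [r1 r10 wr1] := ball_at x Ax xB; have [r2 r20 wr2] := ball_at y Ay yB.
  (* The supports [x, x + 2 d] and [y, y + 2 d] then stay inside ]A, B[ and where w varies by at
     most e. *)
  pose d := Num.min (Num.min r1 r2) (Num.min (B - x) (B - y)) / 4.
  have d0 : 0 < d by rewrite divr_gt0// !lt_min r10 r20 !subr_gt0 xB yB.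
  have [dr1 dr2 dx dy] : [/\ 4 * d <= r1, 4 * d <= r2, 4 * d <= B - x & 4 * d <= B - y].
    rewrite /d mulrC divfK//.
    by rewrite !ge_min !lexx !orbT.
  (* A single step is not compactly supported; the two cancel to the right of both transitions. *)
  pose eta := quadratic_step x d \- quadratic_step y d.
  have [Ceta Deta] := C1B (C1_quadratic_step x d0) (C1_quadratic_step y d0).
  have H : \int[mu]_(x in `[A, B]) (w x * derive1 eta x) = 0.
    apply: (w0 eta (Num.min x y) (Num.max x y + 2 * d)) => //.
    - by rewrite lt_min Ax Ay.
    - by rewrite (@le_trans _ _ x) ?ge_min ?lexx// ler_wpDr ?le_max ?lexx//; lra.
    - by rewrite -ltrBrDr gt_max; apply/andP; split; lra.
    move=> z; rewrite negb_and -!ltNge => /orP[].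
      rewrite lt_min => /andP[zx zy].
      by rewrite /eta/= !quadratic_step_eq0 ?subrr// ltW.
    rewrite -ltrBrDr gt_max => /andP[zx zy].
    by rewrite /eta/= !quadratic_step_eq1 ?subrr//; lra.
  have ih (a : R) : mu.-integrable `[A, B] (EFin \o hat a d).
    by apply: integrable_continuous_itv; apply: continuous_subspaceT; exact: continuous_hat.
  have iwh (a : R) : mu.-integrable `[A, B] (EFin \o (fun z => w z * hat a d z)).
    apply: integrable_continuous_itv; apply/subspace_continuousP => z Dz; apply: cvgM.
      by move/subspace_continuousP : cw; apply.
    by apply: cvg_within_filter; exact: continuous_hat.
  have ich (a c : R) : mu.-integrable `[A, B] (EFin \o (fun z => c * hat a d z)).
    rewrite (_ : _ \o _ = (fun z => c%:E * (EFin \o hat a d) z)%E)//.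
    exact: integrableZl.
  have hat1 (a c : R) : A < a -> 4 * d <= B - a ->
      \int[mu]_(z in `[A, B]) (c * hat a d z) = c.
    move=> Aa aB; rewrite RintegralZl// -(derive1_quadratic_step a d0).
    rewrite Rintegral_derive1 ?(ltW AB)//; last exact: C1_quadratic_step.
    by rewrite quadratic_step_eq1 ?quadratic_step_eq0 ?subr0 ?mulr1//; lra.
  move: H; rewrite Deta derive1_quadratic_step// derive1_quadratic_step//.
  under eq_Rintegral do rewrite mulrBr.
  rewrite RintegralB// => H.
  have wx : \int[mu]_(z in `[A, B]) (w z * hat x d z) <= w x + e.
    rewrite -[leRHS](hat1 x (w x + e))//; apply: le_Rintegral => // z _.
    have [/andP[xz zx]|nz] := boolP (x <= z <= x + 2 * d); last by rewrite hat_eq0// !mulr0.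
    apply: ler_wpM2r; first exact: hat_ge0.
    have : `|w x - w z| <= e by apply: wr1; rewrite ler0_norm; lra.
    rewrite ler_norml; lra.
  have wy : w y - e <= \int[mu]_(z in `[A, B]) (w z * hat y d z).
    rewrite -[leLHS](hat1 y (w y - e))//; apply: le_Rintegral => // z _.
    have [/andP[yz zy]|nz] := boolP (y <= z <= y + 2 * d); last by rewrite hat_eq0// !mulr0.
    apply: ler_wpM2r; first exact: hat_ge0.
    have : `|w y - w z| <= e by apply: wr2; rewrite ler0_norm; lra.
    rewrite ler_norml; lra.
  by move: H wx wy xy; rewrite /e; lra.
pose c := w ((A + B) / 2).
have wc x : A < x -> x < B -> w x = c.
  move=> Ax xB; have M1 : A < (A + B) / 2 by lra.
  have M2 : (A + B) / 2 < B by lra.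
  apply/eqP; rewrite eq_le !leNgt.
  by apply/andP; split; apply/negP; exact: step.
have -> : w A = c.
  rewrite -(cvg_lim (@Rhausdorff R) cwA); apply: cvg_lim => //.
  apply: (@cvg_trans _ (cst c @ A^'+)); last exact: cvg_cst.
  apply: near_eq_cvg; near=> x; rewrite /cst wc//.
rewrite -(cvg_lim (@Rhausdorff R) cwB); apply/esym; apply: cvg_lim => //.
apply: (@cvg_trans _ (cst c @ B^'-)); last exact: cvg_cst.
apply: near_eq_cvg; near=> x; rewrite /cst wc//.
Unshelve. all: by end_near. Qed.

End DuBoisReymond.

(** * Weak derivatives are densities of primitives, and conversely *)

Section WeakDerivative.
Context {R : realType}.
Notation mu := (@lebesgue_measure R).
Implicit Types (D : set R) (u g eta : R -> R).

Definition is_primitive D u g := forall x y, D x -> D y -> x <= y ->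
  u y - u x = \int[mu]_(z in `[x, y]) g z.

(** On a bounded interval 1 + |g|^2 is integrable, and it dominates |g|. *)
Lemma integrable_itv_square_integrable D g (A B : R) : is_interval D ->
  square_integrable D g -> `[A, B]%classic `<=` D -> mu.-integrable `[A, B] (EFin \o g).
Proof.
move=> iD [mg ig] ABD; have mD := is_interval_measurable iD.
pose one : R -> R := cst 1; pose sqr : R -> R := fun x => `|g x| ^+ 2.
have i1 : mu.-integrable `[A, B] (EFin \o one).
  by apply: integrable_continuous_itv; apply: continuous_subspaceT => x; exact: cvg_cst.
have i2 : mu.-integrable `[A, B] (EFin \o sqr) by apply: integrableS ig.
have mgAB : measurable_fun `[A, B] (EFin \o g).
  by apply/measurable_EFinP; exact: measurable_funS mg.
have i12 : mu.-integrable `[A, B] (EFin \o (one \+ sqr)).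
  rewrite (_ : _ \o _ = (EFin \o one) \+ (EFin \o sqr))%E//.
  exact: integrableD.
apply: le_integrable i12 => //.
move=> x _ /=; rewrite /one /sqr lee_fin [leRHS]ger0_norm; last by rewrite addr_ge0// sqr_ge0.
move: (`|g x|) (normr_ge0 (g x)) => a a0.
by rewrite /cst -subr_ge0 (_ : _ - _ = (a - 2^-1) ^+ 2 + 3 / 4) ?addr_ge0 ?sqr_ge0//; field.
Qed.

Lemma Rintegral_support D (A B : R) (f : R -> R) : `[A, B]%classic `<=` D ->
  (forall x, ~~ (A <= x <= B) -> f x = 0) ->
  \int[mu]_(x in D) f x = \int[mu]_(x in `[A, B]) f x.
Proof.
move=> ABD f0; rewrite Rintegral_mkcond [RHS]Rintegral_mkcond; apply: eq_Rintegral => x _.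
rewrite !patchE; have [xAB|xAB] := boolP (x \in `[A, B]%classic).
  by rewrite mem_set//; apply: ABD; exact/set_mem.
rewrite f0 ?if_same//; apply: contra xAB => H.
by rewrite inE/= in_itv.
Qed.

Lemma derive1_eq0_off (eta : R -> R) (a b z : R) :
  (forall z, ~~ (a <= z <= b) -> eta z = 0) -> ~~ (a <= z <= b) -> derive1 eta z = 0.
Proof.
move=> e0; rewrite negb_and -!ltNge => zab; rewrite derive1E.
have : is_derive z 1 (cst (0 : R)) 0 by exact: is_derive_cst.
move=> H; suff : is_derive z 1 eta 0 by move=> ?; rewrite derive_val.
apply: near_eq_is_derive H; case/orP: zab => zab; near=> y; rewrite /cst e0//.
  by rewrite negb_and -ltNge; apply/orP; left; near: y; exact: lt_nbhsl.
by rewrite negb_and -!ltNge; apply/orP; right; near: y; exact: lt_nbhsr.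
Unshelve. all: by end_near. Qed.

(** With G the primitive of g, integration by parts makes u - G orthogonal to the derivatives of all
    test functions supported in ]A, B[; du Bois-Reymond then equates its values at A and B. *)
Lemma weak_derivative_is_primitive D u g : is_interval D ->
  {within D, continuous u} -> square_integrable D g -> is_weak_derivative D u g ->
  is_primitive D u g.
Proof.
move=> iD cu sg wg A B DA DB; rewrite le_eqVlt => /predU1P[->|AB].
  by rewrite set_itv1 Rintegral_set1 subrr.
have ABD : `[A, B]%classic `<=` D.
  by move=> x; rewrite /= in_itv/=; exact: iD.
have ig := integrable_itv_square_integrable iD sg ABD.
have cuAB := continuous_subspaceW ABD cu.
pose G x := parameterized_integral mu A x g.
have cG : {within `[A, B], continuous G} := parameterized_integral_continuous (ltW AB) ig.
have GA : G A = 0 by rewrite /G /parameterized_integral set_itv1 Rintegral_set1.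
suff : u A - G A = u B - G B.
  by rewrite GA /G /parameterized_integral => H; lra.
apply: (@endpoint_eq_of_orthogonal _ A B (u \- G)) => //.
  by move=> x; apply: cvgB; [exact: cuAB|exact: cG].
move=> eta a b Aa ab bB Ceta eta0.
have [deta ceta] := Ceta.
have abD : `[a, b]%classic `<=` D.
  by move=> x /=; rewrite in_itv/= => /andP[ax xb]; apply: (iD A B) => //;
    rewrite (ltW (lt_le_trans Aa ax)) (ltW (le_lt_trans xb bB)).
have off x : ~~ (A <= x <= B) -> ~~ (a <= x <= b).
  apply: contra => /andP[ax xb].
  by rewrite (ltW (lt_le_trans Aa ax)) (ltW (le_lt_trans xb bB)).
have : test_function D eta.
  split => //; exists `[a, b]%classic; split; first exact: segment_compact.
    apply: (@subset_trans _ `]A, B[%classic).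
      move=> x /=; rewrite !in_itv/= => /andP[ax xb].
      by rewrite (lt_le_trans Aa ax) (le_lt_trans xb bB).
    apply: (@subset_trans _ (interior `[A, B]%classic)); last exact: interiorS.
    by rewrite interior_itv_bnd.
  by move=> x abx; apply: eta0; apply/negP => H; apply: abx; rewrite /= in_itv.
move/wg; rewrite (Rintegral_support ABD); last first.
  by move=> x /off /(derive1_eq0_off eta0) ->; rewrite mulr0.
rewrite [X in _ = - X -> _](Rintegral_support ABD); last first.
  by move=> x /off /eta0 ->; rewrite mulr0.
have eA : eta A = 0 by apply: eta0; rewrite negb_and -ltNge Aa.
have eB : eta B = 0 by apply: eta0; rewrite negb_and -!ltNge bB orbT.
rewrite -(@Rintegral_by_parts_primitive _ A B G)// ?(ltW AB)//; last first.
  by move=> x _ _; rewrite GA subr0.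
have imul (f : R -> R) : {within `[A, B], continuous f} ->
    mu.-integrable `[A, B] (EFin \o (fun z => f z * derive1 eta z)).
  move=> cf; apply: integrable_continuous_itv; apply/subspace_continuousP => z Dz; apply: cvgM.
    by move/subspace_continuousP : cf; apply.
  by apply: cvg_within_filter; exact: ceta.
under [X in _ -> X = _]eq_Rintegral do rewrite mulrBl.
rewrite RintegralB//; [|exact: imul..].
by move=> ->; rewrite subrr.
Qed.

(** Integration by parts on a segment [A, B] of D whose endpoints lie strictly outside the hull of
    the support. There is room for it because K lies in the interior of D. *)
Lemma primitive_is_weak_derivative D u g : is_interval D -> square_integrable D g ->
  is_primitive D u g -> is_weak_derivative D u g.
Proof.
move=> iD sg ug eta [deta ceta [K [cK KD eta0]]].
(* An empty K has neither a least nor a greatest point, so it is settled apart: there eta = 0. *)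
have [KE|/set0P K0] := eqVneq K set0.
  have {}eta0 : eta = cst 0 by apply/funext => x; apply: eta0; rewrite KE.
  have -> : derive1 eta = cst 0 by rewrite eta0; apply/funext => x; rewrite derive1_cst.
  rewrite eta0; under eq_Rintegral do rewrite mulr0.
  under [in RHS]eq_Rintegral do rewrite mulr0.
  by rewrite Rintegral_cst ?mul0r ?oppr0//; exact: is_interval_measurable.
have cid : {within K, continuous (idfun : R -> R)} by apply: continuous_subspaceT => x; exact: cvg_id.
have [a /set_mem aK amin] := compact_EVT_min K0 cK cid.
have [b /set_mem bK bmax] := compact_EVT_max K0 cK cid.
have eta0' z : ~~ (a <= z <= b) -> eta z = 0.
  move=> zab; apply: eta0 => Kz; move/negP: zab; apply.
  by have /= := amin z (mem_set Kz); have /= := bmax z (mem_set Kz) => -> ->.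
have [A Aa DA] : exists2 A, A < a & D A.
  have /nbhs_ballP[r /= r0 rD] := KD _ aK; exists (a - r / 2).
    by rewrite ltrBlDr ltrDl divr_gt0.
  apply: rD; rewrite /ball/= opprB addrC subrK gtr0_norm ?divr_gt0//.
  by rewrite ltr_pdivrMr// ltr_pMr// ltrDl.
have [B bB DB] : exists2 B, b < B & D B.
  have /nbhs_ballP[r /= r0 rD] := KD _ bK; exists (b + r / 2).
    by rewrite ltrDl divr_gt0.
  apply: rD; rewrite /ball/= opprD addrA subrr sub0r normrN gtr0_norm ?divr_gt0//.
  by rewrite ltr_pdivrMr// ltr_pMr// ltrDl.
have ab : a <= b := amin b (mem_set bK).
have ABD : `[A, B]%classic `<=` D.
  by move=> x; rewrite /= in_itv/=; exact: iD.
have off x : ~~ (A <= x <= B) -> ~~ (a <= x <= b).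
  apply: contra => /andP[ax xb].
  by rewrite (ltW (lt_le_trans Aa ax)) (ltW (le_lt_trans xb bB)).
rewrite (Rintegral_support ABD); last first.
  by move=> x /off /(derive1_eq0_off eta0') ->; rewrite mulr0.
rewrite [X in _ = - X](Rintegral_support ABD); last first.
  by move=> x /off /eta0' ->; rewrite mulr0.
have AB : A <= B by rewrite ltW// (lt_le_trans Aa)// (le_trans ab)// ltW.
apply: Rintegral_by_parts_primitive => //.
- by apply: eta0'; rewrite negb_and -ltNge Aa.
- by apply: eta0'; rewrite negb_and -!ltNge bB orbT.
- exact: integrable_itv_square_integrable sg ABD.
move=> x Ax xB; apply: ug => //; apply: (iD A B) => //.
by rewrite Ax xB.
Qed.

End WeakDerivative.

(** * Superlevel sets on one edge *)

Section Crossing.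
Context {R : realType}.

Lemma IVT_level (u : R -> R) (a b v : R) : a <= b -> {within `[a, b], continuous u} ->
  u a <= v -> v <= u b -> exists2 c, a <= c <= b & u c = v.
Proof.
move=> ab cu av vb.
have [|c cab cv] := @IVT R u a b v ab cu.
  by rewrite ge_min le_max av vb orbT.
by exists c => //; move: cab; rewrite in_itv.
Qed.

(** Take b' as the first point at level t and a' as the last point before b' at level s; by the
    intermediate value theorem u cannot leave ]s, t[ in between. *)
Lemma crossing_up (u : R -> R) (a b s t : R) : a <= b -> {within `[a, b], continuous u} ->
  s < t -> u a <= s -> t <= u b ->
  exists a' b', [/\ a <= a', a' < b', b' <= b, u a' = s /\ u b' = t
    & forall z, a' < z -> z < b' -> s < u z < t].
Proof.
move=> ab cu st uas tub.
have sub x y : a <= x -> y <= b -> {within `[x, y], continuous u}.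
  move=> ax yb; apply: continuous_subspaceW cu => z /=; rewrite !in_itv/=.
  by move=> /andP[xz zy]; rewrite (le_trans ax)//= (le_trans zy).
have comp x y v : a <= x -> y <= b -> compact (`[x, y]%classic `&` [set z | u z = v]).
  move=> ax yb; apply: (@subclosed_compact _ _ `[x, y]%classic);
    [|exact: segment_compact|by move=> z []].
  rewrite closed_setSI; last exact: itv_closed.
  have /continuous_closedP /(_ [set v]) := sub x y ax yb; apply; exact: closed_eq.
have cid (K : set R) : {within K, continuous (idfun : R -> R)}.
  by apply: continuous_subspaceT => x; exact: cvg_id.
have [b' /set_mem [/= + ub'] bmin] : exists2 c, c \in `[a, b]%classic `&` [set z | u z = t]
    & forall z, z \in `[a, b]%classic `&` [set z | u z = t] -> c <= z.
  apply: (compact_EVT_min _ (comp a b t (lexx _) (lexx _)) (cid _)).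
  have [|c cab uc] := IVT_level ab cu _ tub; first exact: le_trans uas (ltW st).
  by exists c; split => //=; rewrite in_itv.
rewrite in_itv/= => /andP[ab' b'b].
have [a' /set_mem [/= + ua'] amax] : exists2 c, c \in `[a, b']%classic `&` [set z | u z = s]
    & forall z, z \in `[a, b']%classic `&` [set z | u z = s] -> z <= c.
  apply: (compact_EVT_max _ (comp a b' s (lexx _) b'b) (cid _)).
  have [|c cab uc] := IVT_level ab' (sub _ _ (lexx _) b'b) uas; first by rewrite ub' ltW.
  by exists c; split => //=; rewrite in_itv.
rewrite in_itv/= => /andP[aa' a'b'].
exists a', b'; split => //.
  by rewrite lt_neqAle a'b' andbT; apply/eqP => E; move: st; rewrite -ua' -ub' E ltxx.
move=> z a'z zb'; apply/andP; split; rewrite ltNge; apply/negP => H.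
  have az := le_trans aa' (ltW a'z).
  have [|c /andP[zc cb'] uc] := IVT_level (ltW zb') (sub _ _ az b'b) H; first by rewrite ub' ltW.
  have : c <= a' by apply: amax; rewrite inE/= in_itv/= (le_trans az zc) cb'.
  by rewrite leNgt (lt_le_trans a'z zc).
have az := le_trans aa' (ltW a'z).
have zb := le_trans (ltW zb') b'b.
have [|c /andP[ac cz] uc] := IVT_level az (sub _ _ (lexx _) zb) _ H.
  exact: le_trans uas (ltW st).
have : b' <= c by apply: bmin; rewrite inE/= in_itv/= ac (le_trans cz zb).
by rewrite leNgt (le_lt_trans cz zb').
Qed.

Lemma crossing_down (u : R -> R) (a b s t : R) : a <= b -> {within `[a, b], continuous u} ->
  s < t -> t <= u a -> u b <= s ->
  exists a' b', [/\ a <= a', a' < b', b' <= b, u a' = t /\ u b' = s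
    & forall z, a' < z -> z < b' -> s < u z < t].
Proof.
move=> ab cu st tua ubs.
have cNu : {within `[a, b], continuous (fun x => - u x)}.
  by move=> x; apply: cvgN; exact: cu.
have [|||a' [b' [aa' a'b' b'b [ua ub] uab]]] := @crossing_up _ a b (- t) (- s) ab cNu.
- by rewrite ltrN2.
- by rewrite lerN2.
- by rewrite lerN2.
exists a', b'; split => //.
  by split; apply: oppr_inj.
by move=> z az zb; have := uab z az zb; rewrite !ltrN2 andbC.
Qed.

(** Cauchy-Schwarz for the vectors (sqrt a, sqrt c) and (sqrt b, sqrt d), without square roots. It
    adds up increment bounds: for two crossings of the same window, x = y and the factor 4
    appears. *)
Lemma sqrD_le_mul (x y a b c d : R) : 0 <= x -> 0 <= y -> 0 <= a -> 0 <= b -> 0 <= c -> 0 <= d ->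
  x ^+ 2 <= a * b -> y ^+ 2 <= c * d -> (x + y) ^+ 2 <= (a + c) * (b + d).
Proof.
move=> x0 y0 a0 b0 c0 d0 xab ycd.
have H : (x * y) ^+ 2 <= ((a * d + c * b) / 2) ^+ 2.
  apply: (@le_trans _ _ ((a * b) * (c * d))).
    by rewrite exprMn ler_pM// ?sqr_ge0.
  rewrite -subr_ge0 (_ : _ - _ = ((a * d - c * b) / 2) ^+ 2) ?sqr_ge0//.
  by field.
move: H; rewrite ler_pXn2r ?nnegrE ?mulr_ge0 ?divr_ge0 ?addr_ge0 ?mulr_ge0// => H.
rewrite sqrrD; lra.
Qed.

End Crossing.

(** * Increment bounds on a single edge *)

Section Edge.
Context {R : realType}.
Notation mu := (@lebesgue_measure R).
Variables (D : set R) (u g : R -> R).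
Hypothesis iD : is_interval D.
Hypothesis cu : {within D, continuous u}.
Hypothesis sg : square_integrable D g.
Hypothesis ug : is_primitive D u g.

Definition superlevel_measure (t : R) := fine (mu (D `&` [set x | (t < u x)%R])).
Definition sublevel_energy (t : R) := \int[mu]_(x in D `&` [set x | u x < t]) (`|g x| ^+ 2).

Hypothesis fin : forall t : R, 0 < t -> (mu (D `&` [set x | (t < u x)%R]) < +oo)%E.

Let mD : measurable D. Proof. exact: is_interval_measurable. Qed.

Lemma within_continuous_measurable : measurable_fun D u.
Proof. exact: subspace_continuous_measurable_fun. Qed.
Let mu_ := within_continuous_measurable.

Let subD a b : D a -> D b -> `[a, b]%classic `<=` D.
Proof. by move=> Da Db x; rewrite /= in_itv/=; exact: iD. Qed.

Lemma measurable_preimage_within (I : interval R) : measurable (D `&` u @^-1` [set` I]).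
Proof. exact: mu_. Qed.

Lemma measurable_superlevel (t : R) : measurable (D `&` [set x | t < u x]).
Proof.
have := measurable_preimage_within `]t, +oo[; congr measurable.
by apply/seteqP; split => x /=; rewrite in_itv/= andbT.
Qed.

Lemma measurable_sublevel (t : R) : measurable (D `&` [set x | u x < t]).
Proof.
exact: (measurable_preimage_within `]-oo, t[).
Qed.

(** Cauchy-Schwarz, obtained by integrating (g - l)^2 >= 0 where l is the mean slope of u on
    [x, y]. *)
Lemma sqr_increment_le_energy x y : D x -> D y -> x <= y ->
  (u y - u x) ^+ 2 <= (y - x) * \int[mu]_(z in `[x, y]) (`|g z| ^+ 2).
Proof.
move=> Dx Dy; rewrite le_eqVlt => /predU1P[->|xy].
  by rewrite !subrr mul0r expr2 mul0r.
have xyD := subD Dx Dy.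
have ig := integrable_itv_square_integrable iD sg xyD.
have i2 : mu.-integrable `[x, y] (EFin \o (fun z => `|g z| ^+ 2)).
  by case: sg => _ i; apply: integrableS i.
have i1 (c : R) : mu.-integrable `[x, y] (EFin \o (fun z => c)).
  by apply: integrable_continuous_itv; apply: continuous_subspaceT => z; exact: cvg_cst.
pose l := (u y - u x) / (y - x).
have il : mu.-integrable `[x, y] (EFin \o (fun z => 2 * l * g z)).
  rewrite (_ : _ \o _ = (fun z => (2 * l)%:E * (EFin \o g) z)%E)//.
  exact: integrableZl.
have isum : mu.-integrable `[x, y] (EFin \o (fun z => `|g z| ^+ 2 + l ^+ 2)).
  pose sq z : R := `|g z| ^+ 2; pose cl (z : R) := l ^+ 2.
  rewrite (_ : _ \o _ = (EFin \o sq) \+ (EFin \o cl))%E//.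
  by apply: integrableD => //; exact: i1.
have : \int[mu]_(z in `[x, y]) (2 * l * g z) <=
    \int[mu]_(z in `[x, y]) (`|g z| ^+ 2 + l ^+ 2).
  apply: le_Rintegral => // z _.
  by rewrite real_normK ?num_real// -subr_ge0 (_ : _ - _ = (g z - l) ^+ 2) ?sqr_ge0//; ring.
rewrite RintegralZl// -ug ?(ltW xy)// RintegralD//.
rewrite Rintegral_cst//= lebesgue_measure_itv/= lte_fin xy -EFinD/=.
have yx0 : 0 < y - x by rewrite subr_gt0.
have lE : u y - u x = l * (y - x) by rewrite /l mulfVK// gt_eqF.
rewrite lE; set q := Rintegral _ _ _ => H.
rewrite [leLHS](_ : _ = (y - x) * (l ^+ 2 * (y - x))); last by ring.
by rewrite ler_pM2l//; move: H; lra.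
Qed.

Let isq (V : set R) : measurable V -> V `<=` D ->
  mu.-integrable V (EFin \o (fun z => `|g z| ^+ 2)).
Proof. by move=> mV VD; case: sg => _ i; apply: integrableS i. Qed.

(** V is disjoint from {u > t} and their union lies in {u > s}; likewise V is disjoint from {u < s}
    and their union lies in {u < t}. *)
Lemma window_measure_energy (s t : R) (V : set R) : 0 < s -> s < t -> measurable V ->
  V `<=` D -> (forall z, V z -> s < u z < t) ->
  (mu V <= (superlevel_measure s - superlevel_measure t)%:E)%E /\
  \int[mu]_(z in V) (`|g z| ^+ 2) <= sublevel_energy t - sublevel_energy s.
Proof.
move=> s0 st mV VD Vst; have t0 := lt_trans s0 st; split.
  have mt := measurable_superlevel t; have ms := measurable_superlevel s.
  rewrite EFinB leeBrDr// !fineK ?ge0_fin_numE ?fin//.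
  rewrite -measureU//; last first.
    apply/seteqP; split => // z [Vz [_ /=]].
    by rewrite ltNge (ltW (andP (Vst z Vz)).2).
  apply: le_measure; rewrite ?inE//; first exact: measurableU.
  move=> z [Vz|[Dz tz]]; split => //=; first exact: VD.
    by have /andP[] := Vst z Vz.
  exact: lt_trans st tz.
have mt := measurable_sublevel t; have ms := measurable_sublevel s.
rewrite lerBrDr -Rintegral_setU//; first last.
- apply/disj_setPS => z [Vz [_ /=]].
  by rewrite ltNge (ltW (andP (Vst z Vz)).1).
- apply: isq; first exact: measurableU.
  by rewrite subUset; split => // z [].
have sub : V `|` (D `&` [set x | u x < s]) `<=` D `&` [set x | u x < t].
  move=> z [Vz|[Dz zs]]; split => //=; first exact: VD.
    by have /andP[] := Vst z Vz.
  exact: lt_trans zs st.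
apply: fine_le.
- by apply: integrable_fin_num; [exact: measurableU|apply: isq; [exact: measurableU|move=> z /sub[]]].
- by apply: integrable_fin_num => //; apply: isq => // z [].
apply: ge0_subset_integral => //.
- exact: measurableU.
- by apply/measurable_EFinP/measurable_funX/measurableT_comp => //; apply: measurable_funS (proj1 sg) => // z [].
Qed.

Lemma itv_window (a b s t : R) : 0 < s -> s < t -> a < b -> D a -> D b ->
  (forall z, a < z -> z < b -> s < u z < t) -> (u b - u a) ^+ 2 = (t - s) ^+ 2 ->
  (t - s) ^+ 2 <= (b - a) * \int[mu]_(z in `]a, b[) (`|g z| ^+ 2).
Proof.
move=> s0 st ab Da Db ust <-.
apply: le_trans (sqr_increment_le_energy Da Db (ltW ab)) _.
rewrite ler_pM2l ?subr_gt0//.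
have i2 : mu.-integrable `[a, b] (EFin \o (fun z => `|g z| ^+ 2)).
  by apply: isq => //; exact: subD.
rewrite -Rintegral_itv_obnd_cbnd -?Rintegral_itv_bndo_bndc//.
- by apply: integrableS i2 => //; exact: subset_itv_oo_cc.
- by apply: integrableS i2 => //; exact: subset_itv_oc_cc.
Qed.

Lemma one_crossing (a b s t : R) : 0 < s -> s < t -> D a -> D b -> a <= b ->
  (u a <= s /\ t <= u b) \/ (t <= u a /\ u b <= s) ->
  exists a' b', [/\ a <= a', a' < b', b' <= b,
    (forall z, `]a', b'[%classic z -> s < u z < t)
    & (t - s) ^+ 2 <= (b' - a') * \int[mu]_(z in `]a', b'[) (`|g z| ^+ 2)].
Proof.
move=> s0 st Da Db ab H.
have cab := continuous_subspaceW (subD Da Db) cu.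
have [a' [b' [aa' a'b' b'b uab W]]] : exists a' b', [/\ a <= a', a' < b', b' <= b,
    (u b' - u a') ^+ 2 = (t - s) ^+ 2 & forall z, a' < z -> z < b' -> s < u z < t].
  case: H => -[ua ub].
    have [a' [b' [? ? ? [ua' ub'] ?]]] := crossing_up ab cab st ua ub.
    by exists a', b'; rewrite ua' ub'.
  have [a' [b' [? ? ? [ua' ub'] ?]]] := crossing_down ab cab st ua ub.
  by exists a', b'; rewrite ua' ub' -opprB sqrrN.
exists a', b'; split => //.
  by move=> z; rewrite /= in_itv/= => /andP[]; exact: W.
apply: itv_window => //; apply: (iD Da Db).
  by rewrite aa' (le_trans (ltW a'b')).
by rewrite b'b andbT (le_trans aa')// ltW.
Qed.

Lemma crossing_sqr_le (a b s t : R) : 0 < s -> s < t -> D a -> D b -> a <= b ->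
  (u a <= s /\ t <= u b) \/ (t <= u a /\ u b <= s) ->
  (t - s) ^+ 2 <= (superlevel_measure s - superlevel_measure t) *
                  (sublevel_energy t - sublevel_energy s).
Proof.
move=> s0 st Da Db ab H.
have [a' [b' [aa' a'b' b'b W q]]] := one_crossing s0 st Da Db ab H.
have VD : `]a', b'[%classic `<=` D.
  by move=> z; rewrite /= in_itv/= => /andP[az zb]; apply: (iD Da Db);
    rewrite (le_trans aa' (ltW az)) (le_trans (ltW zb) b'b).
have [m e] := window_measure_energy s0 st (measurable_itv _) VD W.
move: m; rewrite lebesgue_measure_itv/= lte_fin a'b' -EFinB lee_fin => m.
apply: le_trans q _; apply: ler_pM => //.
- by rewrite subr_ge0 ltW.
- by apply: Rintegral_ge0 => z _; rewrite sqr_ge0.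
Qed.

(** One ascending crossing on the left of x0 and one descending on the right are disjoint, and
    [sqrD_le_mul] turns them into (2 (t - s))^2. *)
Lemma peak_sqr_le (a x0 b s t : R) : 0 < s -> s < t -> D a -> D b -> a <= x0 -> x0 <= b ->
  u a <= s -> t <= u x0 -> u b <= s ->
  4 * (t - s) ^+ 2 <= (superlevel_measure s - superlevel_measure t) *
                      (sublevel_energy t - sublevel_energy s).
Proof.
move=> s0 st Da Db ax0 x0b ua ux0 ub.
have Dx0 : D x0 by apply: (iD Da Db); rewrite ax0.
have [a1 [b1 [aa1 a1b1 b1x W1 q1]]] := one_crossing s0 st Da Dx0 ax0 (or_introl (conj ua ux0)).
have [a2 [b2 [xa2 a2b2 b2b W2 q2]]] := one_crossing s0 st Dx0 Db x0b (or_intror (conj ux0 ub)).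
pose V := `]a1, b1[%classic `|` `]a2, b2[%classic.
have V1 : `]a1, b1[%classic `<=` D.
  by move=> z; rewrite /= in_itv/= => /andP[az zb]; apply: (iD Da Dx0);
    rewrite (le_trans aa1 (ltW az)) (le_trans (ltW zb) b1x).
have V2 : `]a2, b2[%classic `<=` D.
  by move=> z; rewrite /= in_itv/= => /andP[az zb]; apply: (iD Dx0 Db);
    rewrite (le_trans xa2 (ltW az)) (le_trans (ltW zb) b2b).
have mV : measurable V by apply: measurableU.
have dis z : `]a1, b1[%classic z -> `]a2, b2[%classic z -> False.
  rewrite /= !in_itv/= => /andP[_ zb1] /andP[a2z _].
  by have := lt_trans a2z zb1; rewrite ltNge (le_trans b1x).
have VD : V `<=` D by rewrite subUset.
have W z : V z -> s < u z < t by move=> [/W1|/W2].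
have [m e] := window_measure_energy s0 st mV VD W.
have len a' b' : a' < b' -> mu `]a', b'[%classic = (b' - a')%:E.
  by move=> ab; rewrite lebesgue_measure_itv/= lte_fin ab EFinB.
have mVE : mu V = (mu `]a1, b1[%classic + mu `]a2, b2[%classic)%E.
  by rewrite measureU//; apply/seteqP; split => // z [] /dis H /H.
move: m; rewrite mVE !len// -EFinD lee_fin => m.
move: e; rewrite Rintegral_setU//; first last.
- by apply/disj_setPS => z [] /dis H /H.
- exact: isq.
move=> e.
have st0 : 0 <= t - s by rewrite subr_ge0 ltW.
have Q0 (V' : set R) : 0 <= \int[mu]_(z in V') (`|g z| ^+ 2).
  by apply: Rintegral_ge0 => z _; rewrite sqr_ge0.
have b1a1 : 0 <= b1 - a1 by rewrite subr_ge0 ltW.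
have b2a2 : 0 <= b2 - a2 by rewrite subr_ge0 ltW.
have := sqrD_le_mul st0 st0 b1a1 (Q0 _) b2a2 (Q0 _) q1 q2.
rewrite (_ : (t - s + (t - s)) ^+ 2 = 4 * (t - s) ^+ 2); last by ring.
by move=> H; apply: (le_trans H); apply: ler_pM => //; rewrite addr_ge0.
Qed.

Lemma superlevel_measure_nonincreasing (s t : R) : 0 < s -> s <= t ->
  superlevel_measure t <= superlevel_measure s.
Proof.
move=> s0 st; have t0 := lt_le_trans s0 st.
apply: fine_le; rewrite ?ge0_fin_numE ?fin//.
apply: le_measure; rewrite ?inE; [exact: measurable_superlevel..|].
by move=> z [Dz /= tz]; split => //=; exact: le_lt_trans tz.
Qed.

Lemma sublevel_energy_nondecreasing (s t : R) : s <= t -> sublevel_energy s <= sublevel_energy t.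
Proof.
move=> st; have mt := measurable_sublevel t; have ms := measurable_sublevel s.
apply: fine_le.
- by apply: integrable_fin_num => //; apply: isq => // z [].
- by apply: integrable_fin_num => //; apply: isq => // z [].
apply: ge0_subset_integral => //.
- by apply/measurable_EFinP/measurable_funX/measurableT_comp => //; apply: measurable_funS (proj1 sg) => // z [].
- by move=> z [Dz /= zs]; split => //=; exact: lt_le_trans st.
Qed.

Lemma sublevel_energy_ge0 (t : R) : 0 <= sublevel_energy t.
Proof. by apply: Rintegral_ge0 => z _; rewrite sqr_ge0. Qed.

Lemma sublevel_energy_le (t : R) : sublevel_energy t <= \int[mu]_(x in D) (`|g x| ^+ 2).
Proof.
have mt := measurable_sublevel t; apply: fine_le.
- by apply: integrable_fin_num => //; apply: isq => // z [].
- by apply: integrable_fin_num => //; exact: isq.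
apply: ge0_subset_integral => //.
by apply/measurable_EFinP/measurable_funX/measurableT_comp => //; exact: (proj1 sg).
Qed.

(** Right continuity in the level: the sets {u > t + 1/(n+1)} increase to {u > t}. *)
Lemma superlevel_measure_right (t e : R) : 0 < t -> 0 < e ->
  exists2 d : R, 0 < d & superlevel_measure t - e < superlevel_measure (t + d).
Proof.
move=> t0 e0; apply: contrapT => /forall2NP H.
pose F n := D `&` [set x | t + n.+1%:R^-1 < u x].
have : (mu \o F) n @[n --> \oo] --> mu (\bigcup_n F n).
  apply: nondecreasing_cvg_mu.
  - by move=> n; exact: measurable_superlevel.
  - by apply: bigcup_measurable => n _; exact: measurable_superlevel.
  - move=> m n mn; apply/subsetPset => x [Dx /= mx]; split => //=.
    apply: le_lt_trans mx; rewrite lerD2l lef_pV2 ?posrE//.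
    by rewrite ler_nat.
have -> : \bigcup_n F n = D `&` [set x | t < u x].
  apply/seteqP; split => [x [n _ [Dx /= xn]]|x [Dx /= tx]].
    by split => //=; apply: lt_trans xn; rewrite ltrDl.
  have xt : 0 < u x - t by rewrite subr_gt0.
  have [n _ Hn] := near_infty_natSinv_lt (PosNum xt).
  by exists n => //; split => //=; rewrite -ltrBrDl; exact: Hn (leqnn n).
move=> /cvg_lim Hlim; have {Hlim} /esym E := Hlim (@ereal_hausdorff R).
have : (mu (D `&` [set x | (t < u x)%R]) <= (superlevel_measure t - e)%:E)%E.
  rewrite E; apply: lime_le.
    apply: ereal_nondecreasing_is_cvgn => m n mn /=; apply: le_measure; rewrite ?inE.
    - exact: measurable_superlevel.
    - exact: measurable_superlevel.
    move=> x [Dx /= mx]; split => //=.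
    apply: le_lt_trans mx; rewrite lerD2l lef_pV2 ?posrE//.
    by rewrite ler_nat.
  apply: nearW => n /=; have [nH|] := H n.+1%:R^-1; first by exfalso; apply: nH; rewrite invr_gt0.
  move/negP; rewrite -leNgt; rewrite /superlevel_measure => Hn.
  by rewrite /F -[X in (X <= _)%E]fineK ?lee_fin// ge0_fin_numE ?fin// addr_gt0.
rewrite -[X in (X <= _)%E]fineK ?ge0_fin_numE ?fin// lee_fin -/(superlevel_measure t).
by rewrite lerBrDr -subr_le0 addrAC subrr add0r leNgt e0.
Qed.

(** Left continuity in the level: the sets {u > t - d n} decrease to {u >= t}, which has the measure
    of {u > t} because the level t is null. *)
Lemma superlevel_measure_left (t e : R) : 0 < t -> 0 < e ->
  mu (D `&` [set x | u x = t]) = 0%E ->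
  exists2 d : R, 0 < d < t & superlevel_measure (t - d) < superlevel_measure t + e.
Proof.
move=> t0 e0 ut; apply: contrapT => /forall2NP H.
(* The denominators start at 2 so that t - d n stays positive, where superlevel sets have finite
   measure; continuity from above requires this. *)
pose d n : R := t / n.+2%:R.
have d0 n : 0 < d n by rewrite divr_gt0.
have dt n : d n < t by rewrite ltr_pdivrMr// ltr_pMr// ltr1n.
have nid m n : (m <= n)%N -> d n <= d m.
  by move=> mn; rewrite ler_pM2l// lef_pV2 ?posrE// ler_nat !ltnS.
pose F n := D `&` [set x | t - d n < u x].
have niF m n : (m <= n)%N -> F n `<=` F m.
  move=> mn x [Dx /= mx]; split => //=.
  by apply: le_lt_trans mx; rewrite lerD2l lerN2 nid.
have FE : \bigcap_n F n = (D `&` [set x | t < u x]) `|` (D `&` [set x | u x = t]).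
  apply/seteqP; split => [x Fx|x [] [Dx /= tx] n _]; last 2 first.
  - by split => //=; apply: lt_trans tx; rewrite ltrBlDr ltrDl.
  - by split => //=; rewrite tx ltrBlDr ltrDl.
  have [Dx _] := Fx 0%N I.
  have [tx|xt|tx] := ltgtP t (u x); [by left|exfalso|by right].
  have xt0 : 0 < (t - u x) / t by rewrite divr_gt0 ?subr_gt0.
  have [n _ Hn] := near_infty_natSinv_lt (PosNum xt0).
  have /= := Hn n.+1 (leqnSn n); rewrite ltr_pdivlMr// mulrC => Hd.
  have [_ /=] := Fx n I; rewrite ltNge /d => /negP; apply.
  by rewrite lerBrDr -lerBrDl ltW.
have mlev : measurable (D `&` [set x | u x = t]).
  have := measurable_preimage_within `[t, t]; congr measurable.
  by apply/seteqP; split => x /= [Dx]; rewrite /= in_itv/= -eq_le eq_sym;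
    [move/eqP|move/eqP]; split.
have muF : mu (\bigcap_n F n) = mu (D `&` [set x | (t < u x)%R]).
  rewrite FE -[RHS]adde0 -ut; apply: measureU => //; first exact: measurable_superlevel.
  by apply/seteqP; split => // x [[_ /= tx] [_ /= xt]]; move: tx; rewrite xt ltxx.
have : (mu \o F) n @[n --> \oo] --> mu (\bigcap_n F n).
  apply: nonincreasing_cvg_mu.
  - by apply: fin; rewrite subr_gt0.
  - by move=> n; exact: measurable_superlevel.
  - by apply: bigcapT_measurable => n; exact: measurable_superlevel.
  - by move=> m n mn; apply/subsetPset; exact: niF.
rewrite muF => /cvg_lim Hlim; have {Hlim} /esym E := Hlim (@ereal_hausdorff R).
have : ((superlevel_measure t + e)%:E <= mu (D `&` [set x | (t < u x)%R]))%E.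
  rewrite E; apply: lime_ge.
    apply: ereal_nonincreasing_is_cvgn => m n mn /=; apply: le_measure; rewrite ?inE.
    - exact: measurable_superlevel.
    - exact: measurable_superlevel.
    exact: niF.
  apply: nearW => n /=; have [nH|] := H (d n); first by exfalso; apply: nH; rewrite d0 dt.
  move/negP; rewrite -leNgt; rewrite /superlevel_measure => Hn.
  by rewrite /F -[X in (_ <= X)%E]fineK ?lee_fin// ge0_fin_numE ?fin// subr_gt0.
rewrite -[X in (_ <= X)%E]fineK ?ge0_fin_numE ?fin// lee_fin -/(superlevel_measure t).
by rewrite -lerBrDl subrr leNgt e0.
Qed.

End Edge.

(** * The layer cake formula *)

Section LayerCake.
Context {R : realType}.
Notation mu := (@lebesgue_measure R).
Variables (D : set R) (f : R -> R).
Hypothesis mD : measurable D.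
Hypothesis mf : measurable_fun D f.
Hypothesis f0 : forall x, D x -> 0 <= f x.

Let F := f \_ D.
Let mF : measurable_fun setT F. Proof. exact/(measurable_restrictT _ mD). Qed.
Let F0 x : 0 <= F x.
Proof. by rewrite /F patchE; case: ifPn => // /set_mem /f0. Qed.

Let A := [set p : measurableTypeR R * measurableTypeR R | (0 < p.2) && (p.2 < F p.1)].
Let mA : measurable A.
Proof.
rewrite (_ : A = setT `&` (fun p : measurableTypeR R * measurableTypeR R =>
  (0 < p.2) && (p.2 < F p.1)) @^-1` [set true]); last by rewrite setTI.
apply: (@measurable_and _ _ setT (fun p : measurableTypeR R * measurableTypeR R => 0 < p.2)
  (fun p => p.2 < F p.1)) => //.
  exact: measurable_fun_ltr.
by apply: measurable_fun_ltr => //; exact: measurableT_comp mF _.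
Qed.

Let h (p : measurableTypeR R * measurableTypeR R) : \bar R := (\1_A p)%:E.
Let mh : measurable_fun setT h.
Proof. by apply/measurable_EFinP; exact: measurable_indic. Qed.
Let h0 p : (0 <= h p)%E. Proof. by rewrite /h lee_fin. Qed.

Let hG t : (\int[mu]_x h (x, t))%E =
  ((fun t => mu (D `&` [set x | (t < f x)%R])) \_ `]0%R, +oo[) t.
Proof.
rewrite patchE /h.
have [t0|t0] := ltP 0 t.
  rewrite mem_set ?(in_itv, andbT)//=; last by rewrite in_itv/= t0.
  rewrite (_ : D `&` _ = (D `&` [set x | t < f x]) `&` setT); last by rewrite setIT.
  have mDf : measurable (D `&` [set x | t < f x]).
    by have := mf mD (measurable_itv `]t, +oo[); congr measurable;
      apply/seteqP; split => x /=; rewrite in_itv/= andbT.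
  rewrite -integral_indic//; apply: eq_integral => x _.
  congr (_%:E); rewrite !indicE; congr (_%:R : R); congr nat_of_bool.
  apply/idP/idP; rewrite !inE /A /F/= patchE t0/=.
    by case: ifPn => [/set_mem Dx tf|_]; [split|rewrite ltNge (ltW t0)].
  by case=> Dx tf; rewrite mem_set.
rewrite memNset; last by rewrite /= in_itv/= andbT; apply/negP; rewrite -leNgt.
apply: integral0_eq => x _; rewrite indicE memNset// /A/=.
by rewrite ltNge t0.
Qed.

Lemma measurable_superlevel_measure :
  measurable_fun (`]0%R, +oo[%classic : set R) (fun t : R => mu (D `&` [set x | (t < f x)%R])).
Proof.
apply/(measurable_restrictT _ _).2 => //.
have := @measurable_fun_fubini_tonelli_G _ _ (measurableTypeR R) (measurableTypeR R) R mu h mh h0.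
by apply: eq_measurable_fun => t _; exact: hG.
Qed.

(** Tonelli for the indicator of the region 0 < t < f x: its sections in t have length f x, its
    sections in x are the superlevel sets. *)
Lemma ge0_integral_layer_cake : (\int[mu]_(x in D) (f x)%:E =
  \int[mu]_(t in `]0%R, +oo[) mu (D `&` [set x | (t < f x)%R]))%E.
Proof.
transitivity (\int[mu]_t \int[mu]_x h (x, t))%E; last first.
  by rewrite [RHS]integral_mkcond; apply: eq_integral => t _; exact: hG.
have <- := @fubini_tonelli _ _ (measurableTypeR R) (measurableTypeR R) R mu mu h mh h0.
rewrite integral_mkcond; apply: eq_integral => x _.
rewrite -[LHS]/((EFin \o f) \_ D x)%E restrict_EFin -/F.
transitivity (mu `]0, (F x)[%classic).
  rewrite lebesgue_measure_itv/= lte_fin; case: ltP => [_|]; first by rewrite sube0.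
  by move=> Fx; congr (_%:E); apply/eqP; rewrite eq_le Fx F0.
rewrite -[X in mu X]setIT -integral_indic//; apply: eq_integral => t _.
Qed.

End LayerCake.

(** * Superlevel sets of square-integrable functions *)

Section SquareIntegrable.
Context {R : realType}.
Notation mu := (@lebesgue_measure R).

(** Chebyshev: t^2 times the measure is at most the integral of u^2. *)
Lemma superlevel_measure_fin (D : set R) (u : R -> R) (t : R) : measurable D ->
  square_integrable D u -> 0 < t ->
  (mu (D `&` [set x | (t < u x)%R]) < +oo)%E.
Proof.
move=> mD [mu_ iu] t0; set A := D `&` _.
have mA : measurable A.
  have := mu_ mD _ (measurable_itv `]t, +oo[); congr measurable.
  by apply/seteqP; split => x /=; rewrite in_itv/= andbT.
have : (\int[mu]_(x in A) (t ^+ 2)%:E <= \int[mu]_(x in D) (`|u x| ^+ 2)%:E)%E.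
  have msq : measurable_fun D (fun x => (`|u x| ^+ 2)%:E).
    by apply/measurable_EFinP/measurable_funX/measurableT_comp.
  apply: (@le_trans _ _ (\int[mu]_(x in A) (`|u x| ^+ 2)%:E)%E).
    apply: ge0_le_integral => //.
    - by move=> x _; rewrite lee_fin sqr_ge0.
    - by apply: measurable_funS msq => // x [].
    move=> x [_ /= tx]; rewrite lee_fin ler_pXn2r ?nnegrE ?(ltW t0)//.
    by rewrite (le_trans (ltW tx))// ler_norm.
  by apply: ge0_subset_integral => // x [].
rewrite integral_cst// => H0.
have H : ((t ^+ 2)%:E * mu A <= \int[mu]_(x in D) (`|u x| ^+ 2)%:E)%E by exact: H0.
have : (\int[mu]_(x in D) (`|u x| ^+ 2)%:E < +oo)%E.
  case/integrableP : iu => _; apply: le_lt_trans; rewrite le_eqVlt; apply/orP; left.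
  by apply/eqP; apply: eq_integral => x _; rewrite gee0_abs// lee_fin sqr_ge0.
move=> /(le_lt_trans H); apply: contraPT; rewrite -leNgt leye_eq => /eqP ->.
by rewrite gt0_muley ?ltxx// lte_fin exprn_gt0.
Qed.

Lemma lebesgue_measure_Nyo (x : R) : mu `]-oo, x[%classic = +oo%E.
Proof. by rewrite lebesgue_measure_itv/= ltNyr. Qed.

Variables (u : R -> R).
Hypothesis su : square_integrable setT u.

Let finT (t : R) : 0 < t -> (mu (setT `&` [set x | (t < u x)%R]) < +oo)%E.
Proof. exact: superlevel_measure_fin. Qed.

Let mT (t : R) : measurable (setT `&` [set x | t < u x]).
Proof.
have := su.1 measurableT _ (measurable_itv `]t, +oo[); congr measurable.
by apply/seteqP; split => x /=; rewrite in_itv/= andbT.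
Qed.

(** Used in place of decay at infinity: otherwise {u > s} would contain a half-line, yet its measure
    is finite. *)
Lemma exists_le_left (s x0 : R) : 0 < s -> exists2 x, x < x0 & u x <= s.
Proof.
move=> s0; apply: contrapT => /forall2NP H.
have := finT s0; apply/negP; rewrite -leNgt -(lebesgue_measure_Nyo x0).
apply: le_measure; rewrite ?inE//; first exact: mT.
move=> x /=; rewrite in_itv/= => xx0; split => //=.
by have [//|/negP] := H x; rewrite -ltNge.
Qed.

Lemma exists_le_right (s x0 : R) : 0 < s -> exists2 x, x0 < x & u x <= s.
Proof.
move=> s0; apply: contrapT => /forall2NP H.
have := finT s0; apply/negP; rewrite -leNgt.
rewrite (_ : +oo%E = mu `]x0, +oo[%classic); last by rewrite lebesgue_measure_itv/= ltry.
apply: le_measure; rewrite ?inE//; first exact: mT.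
move=> x /=; rewrite in_itv/= andbT => xx0; split => //=.
by have [//|/negP] := H x; rewrite -ltNge.
Qed.

(** The sets {u > 1/(n+1)} exhaust the line. This is what makes the rearrangement defined and
    positive at every s >= 0. *)
Lemma superlevel_measure_unbounded (C : R) : (forall x, 0 < u x) ->
  exists2 t : R, 0 < t & C < fine (mu (setT `&` [set x | (t < u x)%R])).
Proof.
move=> u0; apply: contrapT => /forall2NP H.
pose F n := setT `&` [set x | n.+1%:R^-1 < u x].
have : (mu \o F) n @[n --> \oo] --> mu (\bigcup_n F n).
  apply: nondecreasing_cvg_mu => //.
  - by move=> n; exact: mT.
  - by apply: bigcupT_measurable => n; exact: mT.
  - move=> m n mn; apply/subsetPset => x [Dx /= mx]; split => //=.
    apply: le_lt_trans mx; rewrite lef_pV2 ?posrE//.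
    by rewrite ler_nat.
have -> : \bigcup_n F n = `]-oo, +oo[%classic.
  apply/seteqP; split => x //= _.
  have [n _ Hn] := near_infty_natSinv_lt (PosNum (u0 x)).
  by exists n => //; split => //=; exact: Hn (leqnn n).
move=> /cvg_lim Hlim; have {Hlim} E := Hlim (@ereal_hausdorff R).
have : (mu `]-oo, +oo[%classic <= C%:E)%E.
  rewrite -E; apply: lime_le.
    apply: ereal_nondecreasing_is_cvgn => m n mn /=; apply: le_measure; rewrite ?inE//.
    - exact: mT.
    - exact: mT.
    move=> x [Dx /= mx]; split => //=.
    apply: le_lt_trans mx; rewrite lef_pV2 ?posrE//.
    by rewrite ler_nat.
  apply: nearW => n /=; have [nH|] := H n.+1%:R^-1; first by exfalso; apply: nH; rewrite invr_gt0.
  move/negP; rewrite -leNgt => Hn.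
  by rewrite /F -[X in (X <= _)%E]fineK ?lee_fin// ge0_fin_numE ?finT// invr_gt0.
by rewrite lebesgue_measure_itv.
Qed.

End SquareIntegrable.

(** * Power integrals of equimeasurable functions *)

Section PowerIntegrals.
Context {R : realType}.
Notation mu := (@lebesgue_measure R).

Lemma lt_powR_superlevel (a t q : R) : 0 < q -> 0 <= t -> 0 <= a ->
  (t < a `^ q) = (t `^ q^-1 < a).
Proof.
move=> q0 t0 a0; have qV0 : 0 < q^-1 by rewrite invr_gt0.
have K (b : R) : 0 <= b -> (b `^ q) `^ q^-1 = b.
  by move=> b0; rewrite -powRrM mulfV ?powRr1// gt_eqF.
have K' (b : R) : 0 <= b -> (b `^ q^-1) `^ q = b.
  by move=> b0; rewrite -powRrM mulVf ?powRr1// gt_eqF.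
apply/idP/idP => H.
  by rewrite -[ltRHS]K//; apply: gt0_ltr_powR; rewrite ?nnegrE ?powR_ge0.
by rewrite -[ltLHS]K'//; apply: gt0_ltr_powR; rewrite ?nnegrE ?powR_ge0.
Qed.

Lemma measurable_powR_normr (D : set R) (u : R -> R) (q : R) :
  measurable_fun D u -> measurable_fun D (fun x => `|u x| `^ q).
Proof.
move=> mu_; apply: (measurableT_comp (measurable_powR q)).
exact: measurableT_comp.
Qed.

(** For 0 <= u <= C one has u^q <= C^(q-2) u^2. *)
Lemma integral_powR_lty (D : set R) (u : R -> R) (C q : R) : measurable D -> 2 <= q ->
  square_integrable D u -> (forall x, D x -> 0 <= u x <= C) ->
  (\int[mu]_(x in D) (`|u x| `^ q)%:E < +oo)%E.
Proof.
move=> mD q2 [mu_ /integrableP[_ iu]] uC.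
have msq : measurable_fun D (fun x => (`|u x| ^+ 2)%:E).
  by apply/measurable_EFinP; apply: measurable_funX; exact: measurableT_comp.
have q20 : 0 <= q - 2 by rewrite subr_ge0.
apply: (@le_lt_trans _ _ (\int[mu]_(x in D) ((C `^ (q - 2))%:E * (`|u x| ^+ 2)%:E))%E).
  apply: ge0_le_integral => //.
  - by apply/measurable_EFinP; exact: measurable_powR_normr.
  - by apply: measurable_funeM.
  move=> x Dx; have /andP[u0 uxC] := uC x Dx; have C0 := le_trans u0 uxC.
  rewrite -EFinM lee_fin ger0_norm//.
  have pE : u x `^ q = u x `^ (q - 2) * u x ^+ 2.
    rewrite -powR_mulrn// -powRD ?subrK//.
    by apply/implyP; rewrite gt_eqF// (lt_le_trans _ q2).
  rewrite pE.
  apply: ler_wpM2r; first exact: exprn_ge0.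
  by apply: ge0_ler_powR; rewrite ?nnegrE.
rewrite ge0_integralZl//; last by rewrite lee_fin powR_ge0.
apply: lte_mul_pinfty => //; first by rewrite lee_fin powR_ge0.
apply: le_lt_trans iu; rewrite le_eqVlt; apply/orP; left; apply/eqP.
by apply: eq_integral => x _; rewrite gee0_abs// lee_fin exprn_ge0.
Qed.

(** Layer cake on both edges, the level t of u^q being the level t^(1/q) of u. Only the sum over the
    two edges is compared, since the rearrangement moves mass between them. *)
Lemma integral_powR_equimeasurable (D1 D2 : set R) (u1 u2 w1 w2 : R -> R) (q : R) : 0 < q ->
  measurable D1 -> measurable D2 ->
  measurable_fun D1 u1 -> measurable_fun D2 u2 -> measurable_fun D1 w1 -> measurable_fun D2 w2 ->
  (forall x, D1 x -> 0 <= u1 x) -> (forall x, D2 x -> 0 <= u2 x) ->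
  (forall x, D1 x -> 0 <= w1 x) -> (forall x, D2 x -> 0 <= w2 x) ->
  (forall t : R, 0 < t ->
    (mu (D1 `&` [set x | (t < u1 x)%R]) + mu (D2 `&` [set x | (t < u2 x)%R]) =
     mu (D1 `&` [set x | (t < w1 x)%R]) + mu (D2 `&` [set x | (t < w2 x)%R]))%E) ->
  (\int[mu]_(x in D1) (`|u1 x| `^ q)%:E + \int[mu]_(x in D2) (`|u2 x| `^ q)%:E =
   \int[mu]_(x in D1) (`|w1 x| `^ q)%:E + \int[mu]_(x in D2) (`|w2 x| `^ q)%:E)%E.
Proof.
move=> q0 m1 m2 mu1 mu2 mw1 mw2 u10 u20 w10 w20 e.
have p0 (u : R -> R) x : 0 <= `|u x| `^ q by exact: powR_ge0.
have LC (D : set R) (u : R -> R) : measurable D -> measurable_fun D u ->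
    (\int[mu]_(x in D) (`|u x| `^ q)%:E =
     \int[mu]_(t in `]0%R, +oo[) mu (D `&` [set x | (t < `|u x| `^ q)%R]))%E.
  by move=> mD mu_; apply: ge0_integral_layer_cake => //; exact: measurable_powR_normr.
have mS (D : set R) (u : R -> R) : measurable D -> measurable_fun D u ->
    measurable_fun (`]0%R, +oo[%classic : set R)
      (fun t : R => mu (D `&` [set x | (t < `|u x| `^ q)%R])).
  by move=> mD mu_; apply: measurable_superlevel_measure => //; exact: measurable_powR_normr.
have add (u1' u2' : R -> R) : measurable_fun D1 u1' -> measurable_fun D2 u2' ->
    (\int[mu]_(x in D1) (`|u1' x| `^ q)%:E + \int[mu]_(x in D2) (`|u2' x| `^ q)%:E =
     \int[mu]_(t in `]0%R, +oo[) (mu (D1 `&` [set x | (t < `|u1' x| `^ q)%R]) +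
       mu (D2 `&` [set x | (t < `|u2' x| `^ q)%R])))%E.
  move=> mu1' mu2'; rewrite (LC _ _ m1 mu1') (LC _ _ m2 mu2'); apply/esym.
  by apply: ge0_integralD => //; exact: mS.
rewrite (add _ _ mu1 mu2) (add _ _ mw1 mw2).
apply: eq_integral => t; rewrite inE/= in_itv/= andbT => t0.
have sE (D : set R) (u : R -> R) : (forall x, D x -> 0 <= u x) ->
    D `&` [set x | t < `|u x| `^ q] = D `&` [set x | t `^ q^-1 < u x].
  move=> u0; apply/seteqP; split => x [Dx /=] H; split => //=; move: H;
    by rewrite ger0_norm ?u0// lt_powR_superlevel ?u0// ltW.
rewrite (sE _ _ u10) (sE _ _ u20) (sE _ _ w10) (sE _ _ w20).
by apply: e; exact: powR_gt0.
Qed.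

End PowerIntegrals.

(** * The rearrangement on the graph *)

Section Distribution.
Context {R : realType}.
Notation mu := (@lebesgue_measure R).
Variables (l : R) (phi psi gphi gpsi : R -> R).
Hypothesis l0 : 0 < l.
Notation pen := (@pendant R l).
Hypothesis cphi : {within setT, continuous phi}.
Hypothesis cpsi : {within pen, continuous psi}.
Hypothesis sphi : square_integrable setT phi.
Hypothesis spsi : square_integrable pen psi.
Hypothesis sgphi : square_integrable setT gphi.
Hypothesis sgpsi : square_integrable pen gpsi.
Hypothesis pphi : is_primitive setT phi gphi.
Hypothesis ppsi : is_primitive pen psi gpsi.
Hypothesis junction : phi 0 = psi 0.
Hypothesis phi_gt0 : forall x, 0 < phi x.
Hypothesis level0 : forall t : R, 0 < t -> level_measure l phi psi t = 0%E.

Let iT : is_interval [set: R]. Proof. by []. Qed.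
Let iI : is_interval pen.
Proof. exact: interval_is_interval. Qed.
Let mI : measurable pen. Proof. exact: is_interval_measurable. Qed.
Let I0 : pen 0. Proof. by rewrite /pendant/= in_itv/= lexx ltW. Qed.

Let finphi (t : R) : 0 < t -> (mu (setT `&` [set x | (t < phi x)%R]) < +oo)%E.
Proof. exact: superlevel_measure_fin. Qed.
Let finpsi (t : R) : 0 < t -> (mu (pen `&` [set x | (t < psi x)%R]) < +oo)%E.
Proof. exact: superlevel_measure_fin. Qed.

Definition distribution (t : R) := superlevel_measure setT phi t + superlevel_measure pen psi t.
Definition graph_energy (t : R) := sublevel_energy setT phi gphi t + sublevel_energy pen psi gpsi t.
Notation M := distribution.
Notation E := graph_energy.

Lemma distribution_nonincreasing (s t : R) : 0 < s -> s <= t -> M t <= M s.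
Proof. by move=> s0 st; rewrite lerD// superlevel_measure_nonincreasing. Qed.

Lemma distribution_ge0 (t : R) : 0 <= M t.
Proof. by rewrite addr_ge0// fine_ge0. Qed.

Lemma graph_energy_nondecreasing (s t : R) : s <= t -> E s <= E t.
Proof. by move=> st; rewrite lerD// sublevel_energy_nondecreasing. Qed.

Lemma graph_energy_ge0 (t : R) : 0 <= E t.
Proof. by rewrite addr_ge0// sublevel_energy_ge0. Qed.

Lemma graph_energy_le (t : R) : E t <=
  \int[mu]_x (`|gphi x| ^+ 2) + \int[mu]_(x in pen) (`|gpsi x| ^+ 2).
Proof. by rewrite lerD// sublevel_energy_le. Qed.

(** The set {phi > 1} has finite measure m1, so within distance m1 + 1 of any point phi drops to 1
    or below; the energy bounds the increment over that distance. *)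
Lemma phi_bounded : exists2 C : R, 0 < C & forall x, phi x <= C.
Proof.
have [G GE] : exists G : R, G = \int[mu]_x (`|gphi x| ^+ 2) by eexists.
have G0 : 0 <= G by rewrite GE; apply: Rintegral_ge0 => x _; rewrite sqr_ge0.
pose m1 := superlevel_measure setT phi 1.
have m10 : 0 <= m1 by rewrite fine_ge0.
have mG0 : 0 <= (m1 + 1) * G by rewrite mulr_ge0// addr_ge0.
exists (1 + ((m1 + 1) * G + 1)); first by lra.
move=> x; have [|px] := leP (phi x) 1.
  by lra.
have [y /andP[xy yx] py] : exists2 y, x <= y <= x + (m1 + 1) & phi y <= 1.
  apply: contrapT => /forall2NP H.
  have : (mu `[x, (x + (m1 + 1))%R] <= m1%:E)%E.
    rewrite /m1 /superlevel_measure fineK ?ge0_fin_numE ?finphi//.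
    apply: le_measure; rewrite ?inE//; first exact: measurable_superlevel.
    move=> y /=; rewrite in_itv/= => xy; split => //=.
    by have [|/negP] := H y; [rewrite xy|rewrite -ltNge].
  rewrite lebesgue_measure_itv/= lte_fin ltrDl ltr_wpDl// -EFinB lee_fin.
  by rewrite addrAC subrr add0r gerDl leNgt ltr01.
have H := @sqr_increment_le_energy _ setT phi gphi iT sgphi pphi x y I I xy.
have q : \int[mu]_(z in `[x, y]) (`|gphi z| ^+ 2) <= G.
  rewrite GE; have i2 : mu.-integrable setT (EFin \o (fun z => `|gphi z| ^+ 2)) by case: sgphi.
  apply: fine_le.
  - by apply: integrable_fin_num => //; apply: integrableS i2.
  - exact: integrable_fin_num i2.
  apply: ge0_subset_integral => //.
  by apply/measurable_EFinP/measurable_funX/measurableT_comp => //; exact: (proj1 sgphi).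
have : (phi x - 1) ^+ 2 <= (m1 + 1) * G.
  apply: (@le_trans _ _ ((phi y - phi x) ^+ 2)).
    have yx1 : phi y <= phi x := le_trans py (ltW px).
    rewrite -(sqrrN (phi y - _)) opprB ler_pXn2r ?nnegrE ?subr_ge0 ?(ltW px)//.
    by rewrite lerD2l lerN2.
  apply: (le_trans H); apply: ler_pM => //; first by rewrite subr_ge0.
    by apply: Rintegral_ge0 => z _; rewrite sqr_ge0.
  by rewrite lerBlDr addrC.
(* Avoids a square root: z <= z^2 + 1 for every z. *)
suff sqr_bound (z X : R) : z ^+ 2 <= X -> z <= X + 1.
  by move=> /sqr_bound H'; rewrite -lerBlDl.
move=> zX; apply: (@le_trans _ _ (z ^+ 2 + 1)); last by rewrite lerD2r.
by rewrite -subr_ge0 (_ : _ - _ = (z - 2^-1) ^+ 2 + 3 / 4) ?addr_ge0 ?sqr_ge0//; field.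
Qed.

Lemma distribution_bounded_support : exists2 C : R, 0 < C & forall t, C <= t -> M t = 0.
Proof.
have [C C0 phiC] := phi_bounded.
have [c _ cmax] := EVT_max (ltW l0) cpsi.
exists (Num.max C (psi c)); first by rewrite lt_max C0.
move=> t; rewrite ge_max => /andP[Ct ct].
have E1 : setT `&` [set x | t < phi x] = set0.
  by apply/seteqP; split => // x [_ /=]; rewrite ltNge (le_trans (phiC x) Ct).
have E2 : pen `&` [set x | t < psi x] = set0.
  apply/seteqP; split => // x [xI /=]; rewrite ltNge (le_trans _ ct)//.
  exact: cmax.
by rewrite /distribution /superlevel_measure E1 E2 measure0 addr0.
Qed.

Lemma distribution_unbounded (s : R) : exists2 t : R, 0 < t & s < M t.
Proof.
have [t t0 st] := superlevel_measure_unbounded sphi s phi_gt0.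
exists t => //; rewrite (lt_le_trans st)// lerDl.
exact: fine_ge0.
Qed.

Lemma distribution_right (t e : R) : 0 < t -> 0 < e ->
  exists2 d : R, 0 < d & M t - e < M (t + d).
Proof.
move=> t0 e0; have e20 : 0 < e / 2 by rewrite divr_gt0.
have [d1 d10 H1] := superlevel_measure_right iT cphi finphi t0 e20.
have [d2 d20 H2] := superlevel_measure_right iI cpsi finpsi t0 e20.
have d0 : 0 < Num.min d1 d2 by rewrite lt_min d10.
exists (Num.min d1 d2) => //.
have td : 0 < t + Num.min d1 d2 by rewrite addr_gt0.
have K1 : superlevel_measure setT phi (t + d1) <= superlevel_measure setT phi (t + Num.min d1 d2).
  by apply: superlevel_measure_nonincreasing => //; rewrite lerD2l ge_min lexx.
have K2 : superlevel_measure pen psi (t + d2) <= superlevel_measure pen psi (t + Num.min d1 d2).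
  by apply: superlevel_measure_nonincreasing => //; rewrite lerD2l ge_min lexx orbT.
by rewrite /distribution; lra.
Qed.

Lemma distribution_left (t e : R) : 0 < t -> 0 < e ->
  exists2 d : R, 0 < d < t & M (t - d) < M t + e.
Proof.
move=> t0 e0; have e20 : 0 < e / 2 by rewrite divr_gt0.
have := level0 t0; rewrite /level_measure.
move=> /eqP; rewrite padde_eq0// => /andP[/eqP lphi /eqP lpsi].
have lphi' : mu (setT `&` [set x | phi x = t]) = 0%E by rewrite setTI.
have [d1 /andP[d10 d1t] H1] := superlevel_measure_left iT cphi finphi t0 e20 lphi'.
have [d2 /andP[d20 d2t] H2] := superlevel_measure_left iI cpsi finpsi t0 e20 lpsi.
have d0 : 0 < Num.min d1 d2 by rewrite lt_min d10.
have dt : Num.min d1 d2 < t by rewrite gt_min d1t.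
exists (Num.min d1 d2); first by rewrite d0.
have td1 : 0 < t - d1 by rewrite subr_gt0.
have td2 : 0 < t - d2 by rewrite subr_gt0.
have K1 : superlevel_measure setT phi (t - Num.min d1 d2) <= superlevel_measure setT phi (t - d1).
  by apply: superlevel_measure_nonincreasing => //; rewrite lerD2l lerN2 ge_min lexx.
have K2 : superlevel_measure pen psi (t - Num.min d1 d2) <= superlevel_measure pen psi (t - d2).
  by apply: superlevel_measure_nonincreasing => //; rewrite lerD2l lerN2 ge_min lexx orbT.
by rewrite /distribution; lra.
Qed.

(** The generalized inverse of the nonincreasing [distribution], meaningful for s >= 0, where the
    set is nonempty and bounded above; [v 0] stands for the maximum of u. *)
Definition decreasing_rearrangement (s : R) := sup [set t | 0 < t /\ s < M t].
Notation v := decreasing_rearrangement.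

Let S_sup (s : R) : 0 <= s -> has_sup [set t | 0 < t /\ s < M t].
Proof.
move=> s0; split; first by have [t t0 st] := distribution_unbounded s; exists t.
have [C C0 MC] := distribution_bounded_support; exists C => t [t0 st].
by rewrite leNgt; apply/negP => Ct; move: st; rewrite MC ?ltNge ?s0// ltW.
Qed.

(** Right continuity of M keeps s < M (t + d) for some d > 0, which pushes the supremum strictly
    above t; hence an equivalence between strict inequalities. *)
Lemma lt_rearrangement (s t : R) : 0 <= s -> 0 < t -> (t < v s) = (s < M t).
Proof.
move=> s0 t0; apply/idP/idP => [tv|st].
  have vt : 0 < v s - t by rewrite subr_gt0.
  have [t' [t'0 st']] := sup_adherent vt (S_sup s0).
  rewrite -/(v s) opprB addrC subrK => tt'.
  by rewrite (lt_le_trans st')//; apply: distribution_nonincreasing (ltW tt').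
have e0 : 0 < M t - s by rewrite subr_gt0.
have [d d0] := distribution_right t0 e0; rewrite opprB addrC subrK => sd.
apply: (@lt_le_trans _ _ (t + d)); first by rewrite ltrDl.
have [_ ubS] := S_sup s0; apply: (ub_le_sup ubS); split; last exact: sd.
exact: addr_gt0.
Qed.

Lemma rearrangement_gt0 (s : R) : 0 <= s -> 0 < v s.
Proof.
move=> s0; have [t t0 st] := distribution_unbounded s.
by apply: (lt_trans t0); rewrite lt_rearrangement.
Qed.

(** The inequality M (v s) <= s comes from [lt_rearrangement]; the converse is left continuity of M,
    which rests on the null levels. *)
Lemma distributionK (s : R) : 0 <= s -> M (v s) = s.
Proof.
move=> s0; have v0 := rearrangement_gt0 s0.
apply/eqP; rewrite eq_le; apply/andP; split.
  by rewrite leNgt -lt_rearrangement// ltxx.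
rewrite leNgt; apply/negP => Ms; have e0 : 0 < s - M (v s) by rewrite subr_gt0.
have [d /andP[d0 dv]] := distribution_left v0 e0; rewrite [ltRHS]addrC subrK ltNge => /negP; apply.
by apply/ltW; rewrite -lt_rearrangement ?subr_gt0// ltrBlDr ltrDl.
Qed.

(** * Increment bounds for the whole graph *)

Let lift_phi (s t : R) (X : R) : 0 < s -> s < t ->
  X <= (superlevel_measure setT phi s - superlevel_measure setT phi t) *
       (sublevel_energy setT phi gphi t - sublevel_energy setT phi gphi s) ->
  X <= (M s - M t) * (E t - E s).
Proof.
(* By monotonicity, the contribution of the other edge can only enlarge both factors. *)
move=> s0 st H; apply: (le_trans H).
have := superlevel_measure_nonincreasing iT cphi finphi s0 (ltW st).
have := superlevel_measure_nonincreasing iI cpsi finpsi s0 (ltW st).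
have := sublevel_energy_nondecreasing iT cphi sgphi (ltW st).
have := sublevel_energy_nondecreasing iI cpsi sgpsi (ltW st).
by move=> *; apply: ler_pM; rewrite /distribution /graph_energy; lra.
Qed.

Let lift_psi (s t : R) (X : R) : 0 < s -> s < t ->
  X <= (superlevel_measure pen psi s - superlevel_measure pen psi t) *
       (sublevel_energy pen psi gpsi t - sublevel_energy pen psi gpsi s) ->
  X <= (M s - M t) * (E t - E s).
Proof.
move=> s0 st H; apply: (le_trans H).
have := superlevel_measure_nonincreasing iT cphi finphi s0 (ltW st).
have := superlevel_measure_nonincreasing iI cpsi finpsi s0 (ltW st).
have := sublevel_energy_nondecreasing iT cphi sgphi (ltW st).
have := sublevel_energy_nondecreasing iI cpsi sgpsi (ltW st).
by move=> *; apply: ler_pM; rewrite /distribution /graph_energy; lra.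
Qed.

Lemma phi_crossing (s t x0 : R) : 0 < s -> s < t -> t <= phi x0 ->
  (t - s) ^+ 2 <= (M s - M t) * (E t - E s).
Proof.
move=> s0 st tx; apply: lift_phi => //.
have [x1 x10 x1s] := exists_le_left sphi x0 s0.
by apply: (crossing_sqr_le iT cphi sgphi pphi finphi s0 st _ _ (ltW x10)) => //; left.
Qed.

(** phi falls to s or below on both sides of x0, so every window below phi x0 is crossed twice. *)
Lemma phi_peak (s t x0 : R) : 0 < s -> s < t -> t <= phi x0 ->
  4 * (t - s) ^+ 2 <= (M s - M t) * (E t - E s).
Proof.
move=> s0 st tx; apply: lift_phi => //.
have [x1 x10 x1s] := exists_le_left sphi x0 s0.
have [x2 x02 x2s] := exists_le_right sphi x0 s0.
by apply: (peak_sqr_le iT cphi sgphi pphi finphi s0 st _ _ (ltW x10) (ltW x02)).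
Qed.

Lemma psi_crossing (s t x y : R) : 0 < s -> s < t -> pen x -> pen y -> x <= y ->
  psi x <= s -> t <= psi y -> (t - s) ^+ 2 <= (M s - M t) * (E t - E s).
Proof.
move=> s0 st Ix Iy xy psx psy; apply: lift_psi => //.
by apply: (crossing_sqr_le iI cpsi sgpsi ppsi finpsi s0 st Ix Iy xy); left.
Qed.

Lemma psi_peak (s t x y z : R) : 0 < s -> s < t -> pen x -> pen z -> x <= y -> y <= z ->
  psi x <= s -> t <= psi y -> psi z <= s ->
  4 * (t - s) ^+ 2 <= (M s - M t) * (E t - E s).
Proof.
move=> s0 st Ix Iz xy yz px py pz; apply: lift_psi => //.
exact: (peak_sqr_le iI cpsi sgpsi ppsi finpsi s0 st Ix Iz xy yz).
Qed.

(** If phi does not reach t, then psi exceeds t somewhere. When the junction value is strictly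
    between s and t, neither edge need cross the whole window: phi crosses the part below phi 0, psi
    the part above, and [sqrD_le_mul] glues them. *)
Let window_lt (s t : R) : 0 < s -> s < t -> t < v 0 ->
  (t - s) ^+ 2 <= (M s - M t) * (E t - E s).
Proof.
move=> s0 st; rewrite lt_rearrangement//; last exact: lt_trans st.
move=> Mt; have [[x0 tx0]|nphi] := pselect (exists x, t <= phi x).
  exact: phi_crossing tx0.
have [y Iy ty] : exists2 y, pen y & t < psi y.
  apply: contrapT => /forall2NP npsi.
  have E1 : setT `&` [set x | t < phi x] = set0.
    by apply/seteqP; split => // x [_ /= tx]; apply: nphi; exists x; exact: ltW.
  have E2 : pen `&` [set x | t < psi x] = set0.
    by apply/seteqP; split => // x [Ix /= tx]; have [//|] := npsi x; rewrite tx.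
  by move: Mt; rewrite /distribution /superlevel_measure E1 E2 measure0 addr0 ltxx.
have y0 : 0 <= y by move: Iy; rewrite /pendant/= in_itv/= => /andP[].
have [tc|ct] := leP t (phi 0); first exact: phi_crossing tc.
have [cs|sc] := leP (phi 0) s.
  by apply: (psi_crossing s0 st I0 Iy y0) (ltW ty); rewrite -junction.
have H1 := phi_crossing s0 sc (lexx (phi 0)).
have H2 : (t - phi 0) ^+ 2 <= (M (phi 0) - M t) * (E t - E (phi 0)).
  by apply: (psi_crossing (phi_gt0 0) ct I0 Iy y0) (ltW ty); rewrite -junction.
rewrite (_ : t - s = (phi 0 - s) + (t - phi 0)); last by ring.
rewrite (_ : (M s - M t) * (E t - E s) = ((M s - M (phi 0)) + (M (phi 0) - M t)) *
  ((E (phi 0) - E s) + (E t - E (phi 0)))); last by ring.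
apply: sqrD_le_mul => //; rewrite ?subr_ge0 ?(ltW sc) ?(ltW ct)//.
- exact/distribution_nonincreasing/ltW.
- exact/graph_energy_nondecreasing/ltW.
- exact/distribution_nonincreasing/ltW.
- exact/graph_energy_nondecreasing/ltW.
Qed.

Lemma window (s t : R) : 0 < s -> s <= t -> t <= v 0 ->
  (t - s) ^+ 2 <= (M s - M t) * (E t - E s).
Proof.
move=> s0; rewrite le_eqVlt => /predU1P[->|st tv].
  by rewrite !subrr mul0r expr2 mul0r.
set X := _ * _.
have X0 : 0 <= X.
  apply: mulr_ge0; rewrite subr_ge0; first exact/distribution_nonincreasing/ltW.
  exact/graph_energy_nondecreasing/ltW.
have H t' : s < t' -> t' < t -> t' - s <= Num.sqrt X.
  move=> st' t't; rewrite -(@ler_pXn2r _ 2)// ?nnegrE ?sqrtr_ge0 ?subr_ge0 ?(ltW st')//.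
  rewrite sqr_sqrtr//; apply: (le_trans (window_lt s0 st' (lt_le_trans t't tv))).
  apply: ler_pM; rewrite ?subr_ge0 ?lerB//.
  - exact/distribution_nonincreasing/ltW.
  - exact/graph_energy_nondecreasing/ltW.
  - by apply: distribution_nonincreasing (ltW t't); exact: lt_trans st'.
  - exact/graph_energy_nondecreasing/ltW.
have {}H : t - s <= Num.sqrt X.
  rewrite leNgt; apply/negP => Hlt.
  have q0 := sqrtr_ge0 X.
  have := H ((s + Num.sqrt X + t) / 2); set q := Num.sqrt X in Hlt q0 *.
  move=> H'; have : s < (s + q + t) / 2 by lra.
  move=> /H' {}H'; have : (s + q + t) / 2 < t by lra.
  move=> /H'; lra.
rewrite -(sqr_sqrtr X0) ler_pXn2r// ?nnegrE ?sqrtr_ge0//.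
by rewrite subr_ge0 ltW.
Qed.

Lemma rearrangement_nonincreasing (a b : R) : 0 <= a -> a <= b -> v b <= v a.
Proof.
move=> a0 ab; have b0 := le_trans a0 ab; rewrite leNgt; apply/negP.
by rewrite lt_rearrangement ?rearrangement_gt0// distributionK// ltNge ab.
Qed.

Lemma rearrangement_decreasing (a b : R) : 0 <= a -> a < b -> v b < v a.
Proof.
move=> a0 ab; have b0 := le_trans a0 (ltW ab).
rewrite lt_neqAle rearrangement_nonincreasing ?(ltW ab)// andbT.
by apply/eqP => e; move: ab; rewrite -(distributionK a0) -(distributionK b0) e ltxx.
Qed.

(** M takes the same value at t and at v (M t), so the window between these levels has right-hand
    side 0, hence width 0. *)
Lemma rearrangementK (t : R) : 0 < t -> t <= v 0 -> v (M t) = t.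
Proof.
move=> t0 tv; have M0 := distribution_ge0 t; have MvM := distributionK M0.
have v0 := rearrangement_gt0 M0; have vv : v (M t) <= v 0 by exact: rearrangement_nonincreasing.
have [H|H] := leP t (v (M t)).
  have := window t0 H vv; rewrite MvM subrr mul0r => K.
  by apply/eqP; rewrite -subr_eq0 -sqrf_eq0 eq_le K sqr_ge0.
have := window v0 (ltW H) tv; rewrite MvM subrr mul0r => K.
by apply/esym/eqP; rewrite -subr_eq0 -sqrf_eq0 eq_le K sqr_ge0.
Qed.

Lemma rearrangement_sqr_le (a b : R) : 0 <= a -> a <= b ->
  (v a - v b) ^+ 2 <= (b - a) * (E (v a) - E (v b)).
Proof.
move=> a0 ab; have b0 := le_trans a0 ab.
have := window (rearrangement_gt0 b0) (rearrangement_nonincreasing a0 ab)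
  (rearrangement_nonincreasing (lexx 0) a0).
by rewrite !distributionK.
Qed.

(** All the length M (v l) = l then lies in the pendant, so {psi > v l} has full measure there; by
    continuity a point with psi < v l would take away an interval. *)
Lemma psi_ge_of_phi_le : (forall x, phi x <= v l) -> forall x, pen x -> v l <= psi x.
Proof.
move=> phile x Ix; rewrite leNgt; apply/negP => px.
have vl0 : 0 < v l by apply: rearrangement_gt0; exact: ltW.
have [r r0 Hr] : exists2 r : R, 0 < r & forall y, pen y -> `|x - y| < r -> psi y < v l.
  have := (subspace_continuousP pen psi).1 cpsi x Ix.
  have e0 : 0 < v l - psi x by rewrite subr_gt0.
  move=> /cvgrPdist_lt /(_ _ e0); rewrite near_withinE => /nbhs_ballP[r /= r0 rb].
  exists r => // y Iy xy; have := rb y xy Iy; rewrite ltr_norml; lra.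
have /andP[x0 xl] : 0 <= x <= l by move: Ix; rewrite /pendant/= in_itv.
pose a := Num.max 0 (x - r); pose b := Num.min l (x + r).
have ab : a < b by rewrite /a /b gt_max !lt_min l0/=; lra.
have K : (mu (pen `&` [set y | (v l < psi y)%R]) + mu `]a, b[%classic <= mu pen)%E.
  rewrite -measureU//; last 2 first.
  - exact: measurable_superlevel.
  - apply/seteqP; split => // y [[Iy /= vy]]; rewrite in_itv/= /a /b gt_max lt_min.
    move=> /andP[/andP[y0 xy] /andP[yl yx]].
    have : psi y < v l by apply: Hr => //; rewrite ltr_norml; lra.
    by rewrite ltNge (ltW vy).
  apply: le_measure; rewrite ?inE//.
    by apply: measurableU => //; exact: measurable_superlevel.
  rewrite subUset; split => [y []//|y /=]; rewrite in_itv/= /a /b gt_max lt_min.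
  by rewrite /pendant/= in_itv/= => /andP[/andP[y0 _] /andP[yl _]]; rewrite !ltW.
have E1 : setT `&` [set x | v l < phi x] = set0.
  by apply/seteqP; split => // y [_ /=]; rewrite ltNge phile.
have := distributionK (ltW l0).
rewrite /distribution /superlevel_measure E1 measure0 add0r => Ml.
move: K; rewrite -[X in (X + _)%E]fineK ?ge0_fin_numE ?finpsi//.
rewrite [fine _]Ml /pendant !lebesgue_measure_itv/= !lte_fin ab l0 -!EFinB -EFinD lee_fin.
by rewrite subr0 gerDl leNgt subr_gt0 ab.
Qed.

(** This places every level below v l under a peak of phi. *)
Lemma phi_reaches : exists x0, v l <= phi x0.
Proof.
apply: contrapT => /forallNP H.
have phile x : phi x < v l by rewrite ltNge; apply/negP; exact: H.
have := psi_ge_of_phi_le (fun x => ltW (phile x)) I0.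
by rewrite -junction leNgt phile.
Qed.

Lemma rearrangement_sqr_le_beyond (a b : R) : l <= a -> a <= b ->
  4 * (v a - v b) ^+ 2 <= (b - a) * (E (v a) - E (v b)).
Proof.
move=> la ab; have a0 := le_trans (ltW l0) la; have b0 := le_trans a0 ab.
have := rearrangement_nonincreasing a0 ab; rewrite le_eqVlt => /predU1P[->|vba].
  by rewrite !subrr expr2 !mulr0.
have [x0 x0l] := phi_reaches.
have := phi_peak (rearrangement_gt0 b0) vba (le_trans (rearrangement_nonincreasing (ltW l0) la) x0l).
by rewrite !distributionK.
Qed.

(** The pendant uses up the first length l of the variable of v; the remainder is shared equally by
    the two half-lines, whence 2 |x|. *)
Definition phi_rearranged (x : R) := v (l + 2 * `|x|).
Definition psi_rearranged (x : R) := v (l - x).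
Notation phit := phi_rearranged.
Notation psit := psi_rearranged.

Let penP x : pen x <-> 0 <= x <= l.
Proof. by rewrite /pendant/= in_itv. Qed.

Let vl0 : 0 < v l. Proof. exact/rearrangement_gt0/ltW. Qed.

Let itv_pen (x y : R) : 0 <= x -> y <= l -> `[x, y]%classic `<=` pen.
Proof.
move=> x0 yl z; rewrite /= in_itv/= => /andP[xz zy].
by apply/penP; rewrite (le_trans x0 xz) (le_trans zy yl).
Qed.

Lemma psit_increasing : increasing_on pen psit.
Proof.
move=> x y /penP/andP[x0 xl] /penP/andP[y0 yl] xy.
by apply: rearrangement_decreasing; rewrite ?subr_ge0// ltrD2l ltrN2.
Qed.

Lemma phit_decreasing : radially_decreasing phit.
Proof.
move=> x y xy; apply: rearrangement_decreasing.
  by rewrite addr_ge0 ?mulr_ge0// ltW.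
by rewrite ltrD2l ltr_pM2l.
Qed.

Lemma psit_sqr_le (x y : R) : 0 <= x -> x <= y -> y <= l ->
  (psit y - psit x) ^+ 2 <= (y - x) * (E (psit y) - E (psit x)).
Proof.
move=> x0 xy yl; have := @rearrangement_sqr_le (l - y) (l - x).
rewrite subr_ge0 lerD2l lerN2 => /(_ yl xy).
by rewrite (_ : l - x - (l - y) = y - x)//; ring.
Qed.

(** Positions a and b on a half-line are 2 (b - a) apart for v, and 4 / 2 = 2: each half-line is
    charged with half of the energy E. *)
Let phit_sqr_le_aux (a b d : R) : 0 <= a -> a <= b -> b - a <= d ->
  (v (l + 2 * b) - v (l + 2 * a)) ^+ 2 <=
  d * (2^-1 * E (v (l + 2 * a)) - 2^-1 * E (v (l + 2 * b))).
Proof.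
move=> a0 ab bad; have b0 := le_trans a0 ab.
have la : l <= l + 2 * a by rewrite lerDl mulr_ge0.
have lab : l + 2 * a <= l + 2 * b by rewrite lerD2l ler_pM2l.
have := rearrangement_sqr_le_beyond la lab.
have vv := rearrangement_nonincreasing (le_trans (ltW l0) la) lab.
have EE := graph_energy_nondecreasing vv.
rewrite (_ : l + 2 * b - (l + 2 * a) = 2 * (b - a)); last by ring.
move: (v (l + 2 * a)) (v (l + 2 * b)) EE => va vb; move: (E va) (E vb) => ea eb EE H.
rewrite -(ler_pM2l (_ : (0 : R) < 4))// -(sqrrN (vb - va)) opprB; apply: (le_trans H).
rewrite [leRHS](_ : _ = 2 * d * (ea - eb)); last by field.
by rewrite ler_wpM2r ?subr_ge0// ler_pM2l.
Qed.

Lemma phit_sqr_le_right (x y : R) : 0 <= x -> x <= y ->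
  (phit y - phit x) ^+ 2 <= (y - x) * (- (2^-1 * E (phit y)) - (- (2^-1 * E (phit x)))).
Proof.
move=> x0 xy; have y0 := le_trans x0 xy.
rewrite opprK [X in _ * X]addrC /phi_rearranged !ger0_norm//.
exact: phit_sqr_le_aux.
Qed.

Lemma phit_sqr_le_left (x y : R) : x <= y -> y <= 0 ->
  (phit y - phit x) ^+ 2 <= (y - x) * (2^-1 * E (phit y) - 2^-1 * E (phit x)).
Proof.
move=> xy y0; have x0 := le_trans xy y0.
rewrite -(sqrrN (_ - _)) opprB /phi_rearranged !ler0_norm//.
apply: phit_sqr_le_aux; rewrite ?oppr_ge0 ?lerN2//.
by rewrite opprK addrC.
Qed.

Lemma psit_energy_le (g : R -> R) (a b : R) : 0 <= a -> a <= b -> b <= l ->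
  mu.-integrable pen (EFin \o g) -> is_primitive pen psit g ->
  (\int[mu]_(x in `[a, b]) ((g x) ^+ 2)%:E <= (E (psit b) - E (psit a))%:E)%E.
Proof.
move=> a0 ab bl ig pg.
apply: (@integral_sqr_le_increment _ a b psit g (fun x => E (psit x))) => //.
- by apply: integrableS ig => //; exact: itv_pen.
- move=> x y ax xy yb; apply: pg => //; apply/penP.
    by rewrite (le_trans a0 ax) (le_trans xy (le_trans yb bl)).
  by rewrite (le_trans a0 (le_trans ax xy)) (le_trans yb bl).
- move=> x y ax xy yb; apply/graph_energy_nondecreasing/rearrangement_nonincreasing.
    by rewrite subr_ge0 (le_trans yb bl).
  by rewrite lerD2l lerN2.
- by move=> x y ax xy yb; apply: psit_sqr_le => //; [exact: le_trans ax|exact: le_trans yb bl].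
Qed.

(** On [-n, 0] and on [0, n] the bound is half of E (v l) minus a nonnegative term; the two halves
    add up and n tends to infinity. *)
Lemma phit_energy_le (g : R -> R) : measurable_fun setT g ->
  (forall A B, mu.-integrable `[A, B] (EFin \o g)) -> is_primitive setT phit g ->
  (\int[mu]_x ((g x) ^+ 2)%:E <= (E (v l))%:E)%E.
Proof.
move=> mg ig pg; pose sq x := ((g x) ^+ 2)%:E.
have msq (A : set R) : measurable A -> measurable_fun A sq.
  by move=> mA; apply/measurable_EFinP/measurable_funX; exact: measurable_funTS.
have sq0 x : (0 <= sq x)%E by rewrite lee_fin sqr_ge0.
have phitE x : phit x <= v l.
  apply: rearrangement_nonincreasing; first exact: ltW.
  by rewrite lerDl mulr_ge0.
have phit0 : phit 0 = v l by rewrite /phi_rearranged normr0 mulr0 addr0.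
pose seg (n : nat) : set R := `[(- n%:R), n%:R]%classic.
have H n : (\int[mu]_(x in seg n) sq x <= (E (v l))%:E)%E.
  have n0 : (0 : R) <= n%:R by [].
  have right : (\int[mu]_(x in `[0%R, n%:R%R]) sq x <=
      (- (2^-1 * E (phit n%:R)) - - (2^-1 * E (phit 0)))%:E)%E.
    apply: (@integral_sqr_le_increment _ 0 n%:R phit g (fun x => - (2^-1 * E (phit x)))) => //.
    - by move=> x y x0 xy _; exact: pg.
    - move=> x y x0 xy _; rewrite lerN2 ler_pM2l//.
      apply/graph_energy_nondecreasing/rearrangement_nonincreasing.
        by rewrite addr_ge0 ?mulr_ge0// ltW.
      by rewrite lerD2l ler_pM2l// !ger0_norm// (le_trans x0).
    - by move=> x y x0 xy _; exact: phit_sqr_le_right.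
  have left : (\int[mu]_(x in `[(- n%:R)%R, 0%R]) sq x <=
      (2^-1 * E (phit 0) - 2^-1 * E (phit (- n%:R)))%:E)%E.
    apply: (@integral_sqr_le_increment _ (- n%:R) 0 phit g (fun x => 2^-1 * E (phit x))) => //.
    - by move=> x y _ xy y0; exact: pg.
    - move=> x y _ xy y0; rewrite ler_pM2l//.
      apply/graph_energy_nondecreasing/rearrangement_nonincreasing.
        by rewrite addr_ge0 ?mulr_ge0// ltW.
      by rewrite lerD2l ler_pM2l// !ler0_norm ?lerN2// (le_trans xy).
    - by move=> x y _ xy y0; exact: phit_sqr_le_left.
  apply: (@le_trans _ _ (\int[mu]_(x in `[(- n%:R)%R, 0%R]) sq x +
      \int[mu]_(x in `[0%R, n%:R%R]) sq x)%E).
    rewrite -(@integral_itv_obnd_cbnd _ 0); last exact: msq.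
    have segU : seg n = `[(- n%:R)%R, 0%R]%classic `|` `]0%R, n%:R%R]%classic.
      apply/seteqP; split => x; rewrite /seg/= !in_itv/=.
        by move=> /andP[nx xn]; have [x0|x0] := leP x 0; [left|right]; rewrite ?nx ?xn.
      by move=> [/andP[nx x0]|/andP[x0 xn]]; rewrite ?nx ?xn ?andbT/=;
        [exact: le_trans n0|rewrite (le_trans _ (ltW x0))// oppr_le0].
    rewrite segU ge0_integral_setU//.
    - by apply: msq; exact: measurableU.
    - apply/disj_setPS => x [] /=; rewrite !in_itv/= => /andP[_ x0] /andP[x0' _].
      by move: x0'; rewrite ltNge x0.
  apply: le_trans (leeD left right) _; rewrite -EFinD lee_fin phit0.
  have := graph_energy_ge0 (phit n%:R); have := graph_energy_ge0 (phit (- n%:R)).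
  move: (E (v l)) (E (phit n%:R)) (E (phit (- n%:R))) => e1 e2 e3; lra.
have U : \bigcup_n seg n = [set: R].
  by rewrite -(bigcup_itvT true false).
rewrite -U.
have := @ge0_nondecreasing_set_cvg_integral _ (measurableTypeR R) R seg sq mu.
move=> C; have {C} /cvg_lim C : (\int[mu]_(x in seg n) sq x)%E @[n --> \oo] -->
    (\int[mu]_(x in \bigcup_n seg n) sq x)%E.
  apply: C.
  - by move=> m n mn; apply/subsetPset/subset_itv; rewrite bnd_simp ?lerN2 ler_nat.
  - by move=> n; exact: measurable_itv.
  - by move=> n; apply: msq; exact: measurable_itv.
  - by move=> n x _; exact: sq0.
rewrite -C//; apply: lime_le.
  apply: ereal_nondecreasing_is_cvgn => m n mn.
  apply: ge0_subset_integral;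
    [exact: measurable_itv|exact: measurable_itv|by apply: msq; exact: measurable_itv|by []|].
  by apply/subset_itv; rewrite bnd_simp ?lerN2 ler_nat.
exact: nearW.
Qed.

Let phit_nonincreasing (x y : R) : 0 <= x -> x <= y -> phit y <= phit x.
Proof.
move=> x0 xy; apply: rearrangement_nonincreasing.
  by rewrite addr_ge0 ?mulr_ge0// ltW.
by rewrite lerD2l ler_pM2l// !ger0_norm// (le_trans x0).
Qed.

Lemma phit_even : even_function phit.
Proof. by move=> x; rewrite /phi_rearranged normrN. Qed.

Lemma phit0 : phit 0 = v l.
Proof. by rewrite /phi_rearranged normr0 mulr0 addr0. Qed.

Lemma psit0 : psit 0 = v l.
Proof. by rewrite /psi_rearranged subr0. Qed.

Lemma phit_le (x : R) : phit x <= v l.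
Proof. by apply: rearrangement_nonincreasing; rewrite ?lerDl ?mulr_ge0// ltW. Qed.

Lemma phit_gt0 (x : R) : 0 < phit x.
Proof. by apply: rearrangement_gt0; rewrite addr_ge0 ?mulr_ge0// ltW. Qed.

Let Etot := \int[mu]_x (`|gphi x| ^+ 2) + \int[mu]_(x in pen) (`|gpsi x| ^+ 2).

Let E_diff_le (s t : R) : E t - E s <= Etot.
Proof. by have := graph_energy_le t; have := graph_energy_ge0 s; rewrite -/Etot; move: (E t) (E s) Etot => a b c; lra. Qed.

Let halfE_diff_le (s t : R) : 2^-1 * E t - 2^-1 * E s <= Etot.
Proof.
have := E_diff_le s t; have := E_diff_le s s; rewrite subrr.
by move: (E t) (E s) Etot => a b c; lra.
Qed.

Let maxr0_dist (x y : R) : x <= y -> Num.max y 0 - Num.max x 0 <= y - x.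
Proof. by move=> xy; have [?|?] := leP x 0; have [?|?] := leP y 0; lra. Qed.

Let le_maxr0 (x y : R) : x <= y -> Num.max x 0 <= Num.max y 0.
Proof. by move=> xy; rewrite ge_max !le_max xy lexx orbT. Qed.

Let minr0_dist (x y : R) : x <= y -> Num.min y 0 - Num.min x 0 <= y - x.
Proof. by move=> xy; have [?|?] := leP x 0; have [?|?] := leP y 0; lra. Qed.

Let le_minr0 (x y : R) : x <= y -> Num.min x 0 <= Num.min y 0.
Proof. by move=> xy; rewrite le_min !ge_min xy lexx orbT. Qed.

(** [density_of_sqr_increment] asks for functions monotone on the whole line, so phit is cut at 0
    into phit (min x 0) and phit (max x 0), the second with its sign reversed. *)
Lemma phit_primitive : exists g : R -> R,
  mu.-integrable setT (EFin \o g) /\ is_primitive setT phit g.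
Proof.
have bnd (x y : R) : phit x - phit y <= v l.
  by have := phit_le x; have := phit_gt0 y; move: (phit x) (phit y) (v l) => a b c; lra.
pose fr x := - phit (Num.max x 0); pose kr x := - (2^-1 * E (phit (Num.max x 0))).
pose fl x := phit (Num.min x 0); pose kl x := 2^-1 * E (phit (Num.min x 0)).
pose B := v l + Etot.
have Etot0 : 0 <= Etot by rewrite addr_ge0// Rintegral_ge0// => x _; rewrite sqr_ge0.
have max0 (x : R) : 0 <= Num.max x 0 by rewrite le_max lexx orbT.
have min0 (x : R) : Num.min x 0 <= 0 by rewrite ge_min lexx orbT.
have ndl (x y : R) : x <= y -> y <= 0 -> phit x <= phit y.
  move=> xy y0; rewrite -(phit_even x) -(phit_even y); apply: phit_nonincreasing.
    by rewrite oppr_ge0.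
  by rewrite lerN2.
have [|||||f1 [_ if1 pf1]] := @density_of_sqr_increment R fr kr B.
- by move=> x y xy; rewrite lerN2; apply: phit_nonincreasing => //; exact: le_maxr0.
- move=> x y xy; rewrite lerN2 ler_pM2l//; apply/graph_energy_nondecreasing/phit_nonincreasing => //.
  exact: le_maxr0.
- by move=> x y _; rewrite /fr opprK addrC (le_trans (bnd _ _))// lerDl.
- by move=> x y _; rewrite /kr opprK addrC (le_trans (halfE_diff_le _ _))// lerDr ltW.
- move=> x y xy; rewrite /fr opprK addrC -(sqrrN (_ - _)) opprB.
  apply: (le_trans (phit_sqr_le_right (max0 x) (le_maxr0 xy))).
  apply: ler_wpM2r; last exact: maxr0_dist.
  rewrite subr_ge0 lerN2 ler_pM2l//; apply/graph_energy_nondecreasing/phit_nonincreasing => //.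
  exact: le_maxr0.
have [|||||f2 [_ if2 pf2]] := @density_of_sqr_increment R fl kl B.
- by move=> x y xy; apply: ndl => //; exact: le_minr0.
- by move=> x y xy; rewrite ler_pM2l//; apply/graph_energy_nondecreasing/ndl => //; exact: le_minr0.
- by move=> x y _; rewrite (le_trans (bnd _ _))// lerDl.
- by move=> x y _; rewrite (le_trans (halfE_diff_le _ _))// lerDr ltW.
- move=> x y xy; apply: (le_trans (phit_sqr_le_left (le_minr0 xy) (min0 y))).
  apply: ler_wpM2r; last exact: minr0_dist.
  rewrite subr_ge0 ler_pM2l//; apply/graph_energy_nondecreasing/ndl => //.
  exact: le_minr0.
exists (fun x => f2 x - f1 x); split.
  rewrite (_ : _ \o _ = (EFin \o f2) \- (EFin \o f1))%E//.
  exact: integrableB.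
have phitE x : phit x = fl x - fr x - v l.
  rewrite /fl /fr opprK; have [x0|x0] := leP x 0.
    by rewrite phit0 addrK.
  by rewrite phit0 addrAC subrr add0r.
move=> x y _ _ xy; rewrite RintegralB//; [|by apply: integrableS if2|by apply: integrableS if1].
rewrite -pf1// -pf2// !phitE.
by move: (fl x) (fl y) (fr x) (fr y) (v l) => *; ring.
Qed.

Lemma psit_primitive : exists g : R -> R,
  mu.-integrable setT (EFin \o g) /\ is_primitive pen psit g.
Proof.
(* Clamping to the pendant extends psit to a monotone function on the whole line and does not
   increase distances. *)
pose c x := Num.max 0 (Num.min l x).
have c0 x : 0 <= c x by rewrite /c le_max lexx.
have cl x : c x <= l by rewrite /c ge_max ge_min lexx ltW.
have cid x : pen x -> c x = x.
  by move=> /penP/andP[x0 xl]; rewrite /c min_r// max_r.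
have lec (x y : R) : x <= y -> c x <= c y.
  move=> xy; rewrite /c ge_max !le_max lexx/= ge_min; apply/orP; right.
  by rewrite le_min ge_min lexx/= ge_min xy orbT.
have cdist (x y : R) : x <= y -> c y - c x <= y - x.
  move=> xy; rewrite /c; have ll := ltW l0.
  by have [?|?] := leP l x; have [?|?] := leP l y; rewrite ?(max_r ll);
    have [?|?] := leP 0 x; have [?|?] := leP 0 y; lra.
have nd (x y : R) : 0 <= x -> x <= y -> y <= l -> psit x <= psit y.
  move=> x0 xy yl; apply: rearrangement_nonincreasing; first by rewrite subr_ge0.
  by rewrite lerD2l lerN2.
have psit_le x : 0 <= x -> x <= l -> psit x <= v 0.
  by move=> x0 xl; apply: rearrangement_nonincreasing; rewrite ?subr_ge0.
have psit_gt0 x : x <= l -> 0 < psit x.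
  by move=> xl; apply: rearrangement_gt0; rewrite subr_ge0.
have Etot0 : 0 <= Etot by rewrite addr_ge0// Rintegral_ge0// => x _; rewrite sqr_ge0.
have [|||||f [_ iF pF]] := @density_of_sqr_increment R (psit \o c) (E \o psit \o c) (v 0 + Etot).
- by move=> x y xy; apply: nd => //; exact: lec.
- by move=> x y xy; apply/graph_energy_nondecreasing/nd => //; exact: lec.
- move=> x y _ /=; have := psit_le _ (c0 y) (cl y); have := psit_gt0 _ (cl x).
  by move: Etot0 (psit _) (psit _); move: (v 0) Etot => *; lra.
- move=> x y _; rewrite (le_trans (E_diff_le _ _))// lerDr.
  exact/ltW/rearrangement_gt0.
- move=> x y xy /=; apply: (le_trans (psit_sqr_le (c0 x) (lec _ _ xy) (cl y))).
  apply: ler_wpM2r; last exact: cdist.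
  by rewrite subr_ge0; apply/graph_energy_nondecreasing/nd => //; exact: lec.
exists f; split => // x y px py xy.
by rewrite -(pF _ _ xy) /= !cid.
Qed.

Lemma equimeasurable (t : R) : 0 < t ->
  (mu (setT `&` [set x | (t < phit x)%R]) + mu (pen `&` [set x | (t < psit x)%R]) =
   mu (setT `&` [set x | (t < phi x)%R]) + mu (pen `&` [set x | (t < psi x)%R]))%E.
Proof.
move=> t0; transitivity (M t)%:E; last first.
  by rewrite /distribution EFinD !fineK// ge0_fin_numE// ?finphi ?finpsi.
have E1 : setT `&` [set x | t < phit x] = [set x | l + 2 * `|x| < M t].
  apply/seteqP; split => x /=; rewrite /phi_rearranged lt_rearrangement//;
    by [case|rewrite addr_ge0 ?mulr_ge0// ltW].
have E2 : pen `&` [set x | t < psit x] = pen `&` [set x | l - x < M t].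
  apply/seteqP; split => x [px] /=; rewrite /psi_rearranged lt_rearrangement//;
    by move/penP : px => /andP[_]; rewrite subr_ge0.
rewrite E1 E2.
have M0 := distribution_ge0 t.
(* Either {u > t} is longer than the pendant, which is then filled, the excess M t - l being centred
   at 0 on the line; or it is a terminal piece of length M t at the tip. *)
have [lM|Ml] := ltP l (M t).
  have -> : [set x | l + 2 * `|x| < M t] = `](- ((M t - l) / 2)), ((M t - l) / 2)[%classic.
    apply/seteqP; split => x /=; rewrite in_itv/= -ltr_norml ltr_pdivlMr//; move: (`|x|) (M t) => a m; lra.
  have -> : pen `&` [set x | l - x < M t] = pen.
    apply/seteqP; split => [x []//|x px]; split => //=.
    move/penP : px => /andP[x0 _]; move: lM x0; move: (M t) => m; lra.
  rewrite /pendant !lebesgue_measure_itv/= !lte_fin l0 ifT; last first.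
    by move: lM; move: (M t) => m; lra.
  by rewrite -!EFinB -EFinD; congr (_%:E); move: (M t) => m; field.
have -> : [set x : R | l + 2 * `|x| < M t] = set0.
  apply/seteqP; split => // x /=; have := normr_ge0 x.
  by move: (`|x|) Ml; move: (M t) => m a ? ? ?; exfalso; lra.
have -> : pen `&` [set x | l - x < M t] = `](l - M t), l]%classic.
  apply/seteqP; split => x /=; rewrite in_itv/=.
    move=> [/penP/andP[x0 xl]]; rewrite xl andbT; move: (M t) => m; lra.
  move=> /andP[x1 x2]; split; last by move: x1; move: (M t) => m; lra.
  by apply/penP; rewrite x2 andbT; move: x1 Ml; move: (M t) => m; lra.
rewrite measure0 add0e lebesgue_measure_itv/= lte_fin.
case: ltP => [_|H].
  by rewrite -EFinB; congr (_%:E); move: (M t) => m; lra.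
by congr (_%:E); move: H M0; move: (M t) => m; lra.
Qed.

(** The bound without the factor 4 covers both half-lines at once, since ||x| - |y|| <= |x - y|. *)
Let phit_continuous : {within setT, continuous phit}.
Proof.
have Etot0 : 0 <= Etot by rewrite addr_ge0// Rintegral_ge0// => x _; rewrite sqr_ge0.
have aux (a b : R) : 0 <= a -> a <= b ->
    (v (l + 2 * a) - v (l + 2 * b)) ^+ 2 <= (b - a) * (2 * Etot).
  move=> a0 ab; have la : 0 <= l + 2 * a by rewrite addr_ge0 ?mulr_ge0// ltW.
  have lab : l + 2 * a <= l + 2 * b by rewrite lerD2l ler_pM2l.
  apply: (le_trans (rearrangement_sqr_le la lab)).
  rewrite (_ : l + 2 * b - (l + 2 * a) = (b - a) * 2); last by ring.
  by rewrite -mulrA ler_wpM2l ?subr_ge0// ler_pM2l.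
apply: (@continuous_of_sqr_increment _ setT (2 * Etot)) => x y _ _ xy.
rewrite /phi_rearranged; have d : `| `|x| - `|y| | <= y - x.
  by rewrite (le_trans (ler_dist_dist _ _))// distrC ger0_norm// subr_ge0.
have d2 : `| `|x| - `|y| | * (2 * Etot) <= (y - x) * (2 * Etot).
  by apply: ler_wpM2r => //; rewrite mulr_ge0.
apply: le_trans d2; have [nxy|/ltW nyx] := leP `|x| `|y|.
  have -> : `| `|x| - `|y| | = `|y| - `|x|.
    by rewrite distrC; apply: ger0_norm; rewrite subr_ge0.
  by rewrite -(sqrrN (_ - _)) opprB; exact: aux.
have -> : `| `|x| - `|y| | = `|x| - `|y| by apply: ger0_norm; rewrite subr_ge0.
exact: aux.
Qed.

Let psit_continuous : {within pen, continuous psit}.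
Proof.
apply: (@continuous_of_sqr_increment _ pen Etot) => x y /penP/andP[x0 _] /penP/andP[_ yl] xy.
apply: (le_trans (psit_sqr_le x0 xy yl)).
by rewrite ler_wpM2l ?subr_ge0.
Qed.

(** * Mass, energy comparison and the equality case *)

Hypothesis psi_gt0 : forall x, pen x -> 0 < psi x.

Let mphi : measurable_fun setT phi := proj1 sphi.
Let mpsi : measurable_fun pen psi := proj1 spsi.
Let mphit : measurable_fun setT phit.
Proof. exact: within_continuous_measurable. Qed.
Let mpsit : measurable_fun pen psit.
Proof. exact: within_continuous_measurable. Qed.

Let psit_gt0 x : pen x -> 0 < psit x.
Proof. by move=> /penP/andP[_ xl]; apply: rearrangement_gt0; rewrite subr_ge0. Qed.

Let powR_eq (q : R) : 0 < q ->
  (\int[mu]_x (`|phit x| `^ q)%:E + \int[mu]_(x in pen) (`|psit x| `^ q)%:E =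
   \int[mu]_x (`|phi x| `^ q)%:E + \int[mu]_(x in pen) (`|psi x| `^ q)%:E)%E.
Proof.
move=> q0; apply: (integral_powR_equimeasurable q0 measurableT mI mphit mpsit mphi mpsi).
- by move=> x _; exact/ltW/phit_gt0.
- by move=> x px; exact/ltW/psit_gt0.
- by move=> x _; exact/ltW/phi_gt0.
- by move=> x px; exact/ltW/psi_gt0.
- by move=> t t0; exact: equimeasurable.
Qed.

Let phi_powR_lty (q : R) : 2 <= q -> (\int[mu]_x (`|phi x| `^ q)%:E < +oo)%E.
Proof.
move=> q2; have [C _ phiC] := phi_bounded.
apply: (@integral_powR_lty _ setT phi C) => // x _.
by rewrite phiC andbT ltW.
Qed.

Let psi_powR_lty (q : R) : 2 <= q -> (\int[mu]_(x in pen) (`|psi x| `^ q)%:E < +oo)%E.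
Proof.
move=> q2; have [c _ cmax] := EVT_max (ltW l0) cpsi.
apply: (@integral_powR_lty _ pen psi (psi c)) => // x px.
by rewrite cmax// andbT ltW// psi_gt0.
Qed.

Let powR_ge0_int (D : set R) (u : R -> R) q : (0 <= \int[mu]_(x in D) (`|u x| `^ q)%:E)%E.
Proof. by apply: integral_ge0 => x _; rewrite lee_fin powR_ge0. Qed.

(** Finiteness is inherited from u through [powR_eq], an equality of extended reals. *)
Let rearranged_powR_lty (q : R) : 2 <= q ->
  (\int[mu]_x (`|phit x| `^ q)%:E < +oo)%E /\
  (\int[mu]_(x in pen) (`|psit x| `^ q)%:E < +oo)%E.
Proof.
move=> q2; have q0 : 0 < q by rewrite (lt_le_trans _ q2).
have := powR_eq q0 => H.
have S : (\int[mu]_x (`|phi x| `^ q)%:E + \int[mu]_(x in pen) (`|psi x| `^ q)%:E < +oo)%E.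
  by apply: lte_add_pinfty; [exact: phi_powR_lty|exact: psi_powR_lty].
rewrite -H in S; split; apply: le_lt_trans S; [exact: leeDl|exact: leeDr].
Qed.

Lemma Rintegral_powR_eq (q : R) : 2 <= q ->
  \int[mu]_x (`|phit x| `^ q) + \int[mu]_(x in pen) (`|psit x| `^ q) =
  \int[mu]_x (`|phi x| `^ q) + \int[mu]_(x in pen) (`|psi x| `^ q).
Proof.
move=> q2; have q0 : 0 < q by rewrite (lt_le_trans _ q2).
have [H1 H2] := rearranged_powR_lty q2.
have fD (a b : \bar R) : (0 <= a)%E -> (0 <= b)%E -> (a < +oo)%E -> (b < +oo)%E ->
    fine a + fine b = fine (a + b)%E.
  by move=> a0 b0 ay by_; rewrite fineD ?ge0_fin_numE.
apply: (etrans (fD _ _ (powR_ge0_int _ _ _) (powR_ge0_int _ _ _) H1 H2)).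
rewrite powR_eq//; apply/esym.
exact: (fD _ _ (powR_ge0_int _ _ _) (powR_ge0_int _ _ _) (phi_powR_lty q2) (psi_powR_lty q2)).
Qed.

Lemma Rintegral_sqr_eq :
  \int[mu]_x (`|phit x| ^+ 2) + \int[mu]_(x in pen) (`|psit x| ^+ 2) =
  \int[mu]_x (`|phi x| ^+ 2) + \int[mu]_(x in pen) (`|psi x| ^+ 2).
Proof.
have e (D : set R) (u : R -> R) :
    \int[mu]_(x in D) (`|u x| ^+ 2) = \int[mu]_(x in D) (`|u x| `^ 2).
  by apply: eq_Rintegral => x _; rewrite powR_mulrn.
by rewrite !e; exact: Rintegral_powR_eq.
Qed.

Let square_integrable_of_powR (D : set R) (u : R -> R) : measurable_fun D u ->
  (\int[mu]_(x in D) (`|u x| `^ 2)%:E < +oo)%E -> square_integrable D u.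
Proof.
move=> mu_ iu; split => //; apply/integrableP; split.
  by apply/measurable_EFinP; apply: measurable_funX; exact: measurableT_comp.
apply: le_lt_trans iu; rewrite le_eqVlt; apply/orP; left; apply/eqP.
by apply: eq_integral => x _; rewrite gee0_abs ?lee_fin ?exprn_ge0// powR_mulrn.
Qed.

Let square_integrable_of_sqr (D : set R) (g : R -> R) (C : R) : measurable_fun D g ->
  (\int[mu]_(x in D) ((g x) ^+ 2)%:E <= C%:E)%E -> square_integrable D g.
Proof.
move=> mg gC; split => //; apply/integrableP; split.
  by apply/measurable_EFinP; apply: measurable_funX; exact: measurableT_comp.
apply: (@le_lt_trans _ _ C%:E); last exact: ltry.
apply: le_trans gC; rewrite le_eqVlt; apply/orP; left; apply/eqP.
by apply: eq_integral => x _; rewrite gee0_abs ?lee_fin ?exprn_ge0// real_normK ?num_real.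
Qed.

Let Rintegral_sqr_le (D : set R) (g : R -> R) (C : R) :
  (\int[mu]_(x in D) ((g x) ^+ 2)%:E <= C%:E)%E ->
  \int[mu]_(x in D) (`|g x| ^+ 2) <= C.
Proof.
move=> H; rewrite /Rintegral -lee_fin fineK.
  by under eq_integral do rewrite real_normK ?num_real//.
rewrite ge0_fin_numE; last by apply: integral_ge0 => x _; rewrite lee_fin exprn_ge0.
under eq_integral do rewrite real_normK ?num_real//.
by rewrite (le_lt_trans H)// ltry.
Qed.

Lemma H1_phit : H1 setT phit.
Proof.
split => //.
  exact: square_integrable_of_powR (rearranged_powR_lty (lexx 2)).1.
have [g [ig pg]] := phit_primitive.
have mg : measurable_fun setT g by case/integrableP : ig => /measurable_EFinP.
have sg : square_integrable setT g.
  by apply: square_integrable_of_sqr mg (phit_energy_le mg _ pg) => A B; apply: integrableS ig.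
by exists g; split => //; exact: primitive_is_weak_derivative.
Qed.

Lemma H1_psit : H1 pen psit.
Proof.
split => //.
  exact: square_integrable_of_powR (rearranged_powR_lty (lexx 2)).2.
have [g [ig pg]] := psit_primitive.
have ig' : mu.-integrable pen (EFin \o g) by apply: integrableS ig.
have mg : measurable_fun pen g by case/integrableP : ig' => /measurable_EFinP.
have sg : square_integrable pen g.
  exact: square_integrable_of_sqr mg (psit_energy_le (lexx 0) (ltW l0) (lexx l) ig' pg).
by exists g; split => //; exact: primitive_is_weak_derivative.
Qed.

(** Stated for every weak derivative g because [weak_derivative] selects an unspecified version. *)
Lemma phit_weak_energy_le (g : R -> R) : square_integrable setT g ->
  is_weak_derivative setT phit g -> \int[mu]_x (`|g x| ^+ 2) <= E (v l).
Proof.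
move=> sg wg; apply: Rintegral_sqr_le; apply: phit_energy_le.
- exact: (proj1 sg).
- by move=> A B; exact: (integrable_itv_square_integrable iT sg).
- exact: weak_derivative_is_primitive.
Qed.

Lemma psit_weak_primitive (g : R -> R) : square_integrable pen g ->
  is_weak_derivative pen psit g ->
  mu.-integrable pen (EFin \o g) /\ is_primitive pen psit g.
Proof.
move=> sg wg; split; first exact: (integrable_itv_square_integrable iI sg).
exact: weak_derivative_is_primitive.
Qed.

Lemma psit_weak_energy_le (g : R -> R) : square_integrable pen g ->
  is_weak_derivative pen psit g ->
  \int[mu]_(x in pen) (`|g x| ^+ 2) <= E (v 0) - E (v l).
Proof.
move=> sg wg; have [ig pg] := psit_weak_primitive sg wg; apply: Rintegral_sqr_le.
have := psit_energy_le (lexx 0) (ltW l0) (lexx l) ig pg.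
by rewrite psit0 /psi_rearranged subrr.
Qed.

(* On a window [s, t] of levels above v l where a level is attained twice, the
   rearrangement gains a factor 4. *)
Lemma psit_weak_energy_lt (g : R -> R) (s t : R) : square_integrable pen g ->
  is_weak_derivative pen psit g -> v l <= s -> s < t -> t <= v 0 ->
  (forall s' t' : R, s <= s' -> s' < t' -> t' <= t ->
     4 * (t' - s') ^+ 2 <= (M s' - M t') * (E t' - E s')) ->
  \int[mu]_(x in pen) (`|g x| ^+ 2) < E (v 0) - E (v l).
Proof.
move=> sg wg ls st tv W; have [ig pg] := psit_weak_primitive sg wg.
have s0 : 0 < s := lt_le_trans vl0 ls.
have t0 := lt_trans s0 st.
have Ms : M s <= l by rewrite -[leRHS]distributionK ?(ltW l0)//; exact: distribution_nonincreasing.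
have Mts := distribution_nonincreasing s0 (ltW st).
have Mt0 := distribution_ge0 t.
(* The points where psit takes the values s and t; between them the improved bound holds, with E / 4
   in place of E. *)
pose y1 := l - M s; pose y2 := l - M t.
have y10 : 0 <= y1 by rewrite subr_ge0.
have y12 : y1 <= y2 by rewrite lerD2l lerN2.
have y2l : y2 <= l by rewrite gerBl.
have psi1 : psit y1 = s.
  by rewrite /psi_rearranged /y1 subKr rearrangementK// (le_trans (ltW st)).
have psi2 : psit y2 = t by rewrite /psi_rearranged /y2 subKr rearrangementK.
have nd (x y : R) : x <= y -> y <= l -> psit x <= psit y.
  move=> xy yl; apply: rearrangement_nonincreasing; first by rewrite subr_ge0.
  by rewrite lerD2l lerN2.
have L1 := Rintegral_sqr_le (psit_energy_le (lexx 0) y10 (le_trans y12 y2l) ig pg).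
have L3 := Rintegral_sqr_le (psit_energy_le (le_trans y10 y12) y2l (lexx l) ig pg).
have L2 : \int[mu]_(x in `[y1, y2]) (`|g x| ^+ 2) <= 4^-1 * E t - 4^-1 * E s.
  apply: Rintegral_sqr_le; rewrite -psi1 -psi2.
  apply: (@integral_sqr_le_increment _ y1 y2 psit g (fun x => 4^-1 * E (psit x))) => //.
  - by apply: integrableS ig => //; exact: itv_pen.
  - move=> x y ax xy yb; apply: pg => //; apply/penP.
      by rewrite (le_trans y10 ax) (le_trans xy (le_trans yb y2l)).
    by rewrite (le_trans y10 (le_trans ax xy)) (le_trans yb y2l).
  - move=> x y ax xy yb; rewrite ler_pM2l//; apply/graph_energy_nondecreasing/nd => //.
    exact: le_trans yb y2l.
  move=> x y ax xy yb; have yl := le_trans yb y2l; have xl := le_trans xy yl.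
  have := nd x y xy yl; rewrite le_eqVlt => /predU1P[->|pxy].
    by rewrite !subrr expr2 !mulr0.
  have sx : s <= psit x by rewrite -psi1 nd.
  have yt : psit y <= t by rewrite -psi2 nd.
  have := W _ _ sx pxy yt; rewrite /psi_rearranged !distributionK ?subr_ge0//.
  move: (E (v (l - x))) (E (v (l - y))) (v (l - x)) (v (l - y)) => ex ey vx vy H.
  rewrite -(ler_pM2l (_ : (0 : R) < 4))//; apply: (le_trans H).
  by rewrite (_ : l - x - (l - y) = y - x); [rewrite le_eqVlt; apply/orP; left; apply/eqP; field|ring].
(* The source of strictness: the window from s to t has positive width, so replacing E by E / 4 on
   it is a real gain. *)
have Est : 0 < E t - E s.
  have := W s t (lexx s) st (lexx t); rewrite ltNge; apply: contraL => Ets.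
  rewrite -ltNge; apply: (@le_lt_trans _ _ 0).
    by apply: mulr_ge0_le0; rewrite ?subr_ge0.
  by rewrite mulr_gt0// exprn_gt0// subr_gt0.
have i2 (x y : R) : 0 <= x -> y <= l -> mu.-integrable `[x, y] (EFin \o (fun z => `|g z| ^+ 2)).
  by move=> x0 yl; case: sg => _ i; apply: integrableS i => //; exact: itv_pen.
have split_at (x y z : R) : 0 <= x -> x <= y -> y <= z -> z <= l ->
    \int[mu]_(w in `[x, z]) (`|g w| ^+ 2) =
    \int[mu]_(w in `[x, y]) (`|g w| ^+ 2) + \int[mu]_(w in `[y, z]) (`|g w| ^+ 2).
  move=> x0 xy yz zl.
  have := @Rintegral_itvB R (fun w => `|g w| ^+ 2) (BLeft x) (BRight z) y (i2 x z x0 zl).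
  rewrite !bnd_simp => /(_ xy yz); rewrite Rintegral_itv_obnd_cbnd; last first.
    by apply: integrableS (i2 x z x0 zl) => //; apply: subset_itv; rewrite bnd_simp.
  by move=> <-; rewrite addrC subrK.
rewrite /pendant (split_at 0 y1 l)// ?(le_trans y12)// (split_at y1 y2 l)//.
move: L1 L2 L3 Est; rewrite psi1 psi2 psit0 /psi_rearranged subrr.
set a := Rintegral _ _ _; set b := Rintegral _ _ _; set c := Rintegral _ _ _.
move: a b c (E t) (E s) (E (v l)) (E (v 0)) => a b c et es el e0; lra.
Qed.

(** An ascent of psi beyond v 0 would cross a window whose measure factor is at most 0, because M (v
    0) = 0. *)
Lemma psi_le_rearrangement0 (x : R) : psi 0 <= v 0 -> pen x -> psi x <= v 0.
Proof.
move=> p0 px; rewrite leNgt; apply/negP => H.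
have v00 : 0 < v 0 by exact: rearrangement_gt0.
have x0 : 0 <= x by move/penP : px => /andP[].
have := psi_crossing v00 H I0 px x0 p0 (lexx _).
rewrite distributionK// sub0r leNgt => /negP; apply.
apply: (@le_lt_trans _ _ 0); last by rewrite exprn_gt0// subr_gt0.
apply: mulr_le0_ge0; first by rewrite oppr_le0 distribution_ge0.
by rewrite subr_ge0; apply/graph_energy_nondecreasing/ltW.
Qed.

(** Any failure of the conclusion produces either a window of factor 4 above v l, contradicting the
    energy hypothesis, or a level of positive measure. *)
Lemma rigidity (g h : R -> R) :
  square_integrable setT g -> is_weak_derivative setT phit g ->
  square_integrable pen h -> is_weak_derivative pen psit h ->
  Etot <= \int[mu]_x (`|g x| ^+ 2) + \int[mu]_(x in pen) (`|h x| ^+ 2) ->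
  increasing_on pen psi /\
  exists m : R, is_minimum (psi @` pen) m /\ is_maximum (range phi) m.
Proof.
move=> sg wg sh wh tot.
have W (s t : R) : v l <= s -> s < t -> t <= v 0 ->
    (forall s' t' : R, s <= s' -> s' < t' -> t' <= t ->
       4 * (t' - s') ^+ 2 <= (M s' - M t') * (E t' - E s')) -> False.
  move=> ls st tv /(psit_weak_energy_lt sh wh ls st tv) lt.
  move: tot; apply/negP; rewrite -ltNge.
  apply: (lt_le_trans (ler_ltD (phit_weak_energy_le sg wg) lt)).
  by rewrite addrC subrK graph_energy_le.
have vl0' : v l < v 0 by exact: rearrangement_decreasing.
(* Otherwise phi has a peak over every level between v l and the smaller of phi x and v 0. *)
have phile x : phi x <= v l.
  rewrite leNgt; apply/negP => H.
  apply: (W (v l) (Num.min (phi x) (v 0)) (lexx _)).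
  - by rewrite lt_min H.
  - by rewrite ge_min lexx orbT.
  move=> s' t' ls s't' t'm; apply: (@phi_peak s' t' x) => //.
    exact: lt_le_trans vl0 ls.
  by rewrite (le_trans t'm)// ge_min lexx.
have psige := psi_ge_of_phi_le phile.
have psi0 : psi 0 = v l by apply/eqP; rewrite eq_le psige// andbT -junction phile.
(* A descent from x to y makes x a peak over the levels between psi y and psi x, because psi starts
   at its lower bound v l at the junction. *)
have nd x y : pen x -> pen y -> x <= y -> psi x <= psi y.
  move=> px py xy; rewrite leNgt; apply/negP => H.
  have pxv : psi x <= v 0 by apply: psi_le_rearrangement0 => //; rewrite psi0 ltW.
  apply: (W (psi y) (psi x) (psige _ py) H pxv).
  move=> s' t' ls s't' t'm.
  have x0 : 0 <= x by move/penP : px => /andP[].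
  apply: (@psi_peak s' t' 0 x y) => //.
    by rewrite (lt_le_trans vl0)// (le_trans (psige _ py)).
  by rewrite psi0 (le_trans (psige _ py)).
split.
  (* Equal values at x < y would make psi constant on [x, y], giving a level of positive measure. *)
  move=> x y px py xy; rewrite lt_neqAle nd ?(ltW xy)// andbT; apply/eqP => e.
  have := level0 (psi_gt0 px); rewrite /level_measure => /eqP.
  rewrite padde_eq0// => /andP[_ /eqP lev].
  have : (mu `[x, y] <= 0)%E.
    rewrite -lev; apply: le_measure; rewrite ?inE//.
      have := measurable_preimage_within iI cpsi `[psi x, psi x]; congr measurable.
      by apply/seteqP; split => z /= [pz]; rewrite /= in_itv/= -eq_le eq_sym;
        [move/eqP|move/eqP]; split.
    move=> z; rewrite /= in_itv/= => /andP[xz zy].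
    have pz : pen z.
      move/penP : px => /andP[x0 _]; move/penP : py => /andP[_ yl].
      by apply/penP; rewrite (le_trans x0 xz) (le_trans zy yl).
    split => //=; apply/eqP; rewrite eq_le; apply/andP; split; last exact: nd.
    by rewrite e; exact: nd.
  by rewrite lebesgue_measure_itv/= lte_fin xy -EFinB lee_fin leNgt subr_gt0 xy.
exists (v l); split; split.
- by exists 0.
- by move=> _ [x px <-]; exact: psige.
- by exists 0; rewrite // junction psi0.
- by move=> _ [x _ <-]; exact: phile.
Qed.

End Distribution.

Theorem lemma6p1 (R : realType) (mass p l : R) (phi psi : R -> R)
    (hmass : 0 < mass) (hp2 : 2 < p) (hp6 : p < 6) (hl : 0 < l)
    (hu : H1_graph_mass l mass phi psi)
    (hpos : positive_graph l phi psi)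
    (hlevel : forall t : R, 0 < t -> level_measure l phi psi t = 0%E) :
  exists phit psit : R -> R,
    [/\ H1_graph_mass l mass phit psit,
        even_function phit /\ radially_decreasing phit,
        [/\ increasing_on (pendant l) psit,
            is_minimum (psit @` pendant l) (psit 0),
            psit 0 = phit 0
          & is_maximum (range phit) (phit 0)]
      & energy l p phit psit <= energy l p phi psi /\
        (energy l p phit psit = energy l p phi psi ->
           increasing_on (pendant l) psi /\
           exists m : R, is_minimum (psi @` pendant l) m /\
                         is_maximum (range phi) m)].
Proof.
(* Once the power terms agree, equality of the energies is equality of the Dirichlet terms, of which
   [rigidity] takes one inequality. *)
have half_cancel (a b c : R) : 2^-1 * a - c = 2^-1 * b - c -> b <= a by lra.
have [[[cphi sphi ephi] [cpsi spsi epsi] jct] hm] := hu.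
have [phi_gt0 psi_gt0] := hpos.
(* [weak_derivative] defaults to 0 when there is no candidate; membership in [H1] makes the selected
   version a genuine weak derivative. *)
have weakP (D : set R) u :
    (exists g, square_integrable D g /\ is_weak_derivative D u g) ->
    square_integrable D (weak_derivative D u) /\
    is_weak_derivative D u (weak_derivative D u).
  exact: (@xgetPex _ _ [set g | square_integrable D g /\ is_weak_derivative D u g]).
have iT : is_interval [set: R] by [].
have iI : is_interval (pendant l) by exact: interval_is_interval.
have [sg wg] := weakP _ _ ephi; have [sh wh] := weakP _ _ epsi.
have pg := weak_derivative_is_primitive iT cphi sg wg.
have ph := weak_derivative_is_primitive iI cpsi sh wh.
set gphi := weak_derivative setT phi in sg wg pg.
set gpsi := weak_derivative (pendant l) psi in sh wh ph.
pose phit := phi_rearranged l phi psi; pose psit := psi_rearranged l phi psi.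
have I0 : pendant l 0 by rewrite /pendant/= in_itv/= lexx ltW.
have H1phit : H1 setT phit.
  exact: (@H1_phit R l phi psi gphi gpsi).
have H1psit : H1 (pendant l) psit.
  exact: (@H1_psit R l phi psi gphi gpsi).
have [_ _ /weakP[sgt wgt]] := H1phit; have [_ _ /weakP[sht wht]] := H1psit.
have junction : psit 0 = phit 0 by rewrite /psit /phit psit0 phit0.
have incr : increasing_on (pendant l) psit.
  exact: (@psit_increasing R l phi psi gphi).
have decr : radially_decreasing phit.
  exact: (@phit_decreasing R l phi psi gphi).
have energy_le : \int[lebesgue_measure]_x (`|weak_derivative setT phit x| ^+ 2) +
    \int[lebesgue_measure]_(x in pendant l) (`|weak_derivative (pendant l) psit x| ^+ 2) <=
    \int[lebesgue_measure]_x (`|gphi x| ^+ 2) +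
    \int[lebesgue_measure]_(x in pendant l) (`|gpsi x| ^+ 2).
  have e1 : \int[lebesgue_measure]_x (`|weak_derivative setT phit x| ^+ 2) <=
      graph_energy l phi psi gphi gpsi (decreasing_rearrangement l phi psi l).
    exact: phit_weak_energy_le.
  have e2 : \int[lebesgue_measure]_(x in pendant l) (`|weak_derivative (pendant l) psit x| ^+ 2) <=
      graph_energy l phi psi gphi gpsi (decreasing_rearrangement l phi psi 0) -
      graph_energy l phi psi gphi gpsi (decreasing_rearrangement l phi psi l).
    exact: psit_weak_energy_le.
  apply: (le_trans (lerD e1 e2)); rewrite addrC subrK.
  exact: graph_energy_le.
have Lp := @Rintegral_powR_eq R l phi psi gphi gpsi hl cphi cpsi sphi spsi sg sh pg ph jct
  phi_gt0 hlevel psi_gt0 p (ltW hp2).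
have energyE u w : energy l p u w =
    2^-1 * (\int[lebesgue_measure]_x (`|weak_derivative setT u x| ^+ 2) +
      \int[lebesgue_measure]_(x in pendant l) (`|weak_derivative (pendant l) w x| ^+ 2)) -
    p^-1 * (\int[lebesgue_measure]_x (`|u x| `^ p) +
      \int[lebesgue_measure]_(x in pendant l) (`|w x| `^ p)).
  by rewrite /energy; ring.
exists phit, psit; split.
- split; first by split.
  rewrite -hm; exact: (@Rintegral_sqr_eq R l phi psi gphi gpsi).
- by split => //; exact: phit_even.
- split; [exact: incr| |exact: junction|].
    split; first by exists 0.
    move=> _ [x px <-]; have /andP[x0 _] : 0 <= x <= l.
      by move: px; rewrite /pendant/= in_itv.
    by have [->//|xn0] := eqVneq x 0; apply/ltW/incr => //; rewrite lt_neqAle eq_sym xn0.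
  split; first by exists 0.
  move=> _ [x _ <-]; have [->//|x0] := eqVneq x 0.
  by apply/ltW/decr; rewrite normr0 normr_gt0.
rewrite (energyE phit psit) (energyE phi psi) Lp; split.
  by rewrite lerD2r ler_pM2l// invr_gt0.
move=> /half_cancel; exact: (@rigidity R l phi psi gphi gpsi hl cphi cpsi sphi spsi sg sh pg ph
  jct phi_gt0 hlevel psi_gt0 _ _ sgt wgt sht wht).
Qed.
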